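(* Let $V_0\in L^2(\mathbb{T}^d;\mathbb{R}^d)$ be a divergence-free vector field of zero spatial mean with $\nabla V_0\in L^2(\mathbb{T}^d;\mathbb{R}^{d\times d})$, and let $\nu_0>0$ be an arbitrary positive number. Then, as $\nu\to0^+$, $$\widetilde{\mathcal{A}^\nu_{NS}}\ \stackrel{\Gamma}{\longrightarrow}\ \widetilde{\mathcal{A}^0_{NS}}\quad\text{in }\ \widetilde{\mathcal{EB}\Psi_{2,\infty,2}}^{w}(\nu_0).$$
   Context: Here $d\in\{2,3\}$, $\mathbb{T}^d=\mathbb{R}^d/\mathbb{Z}^d$, $T>0$, $a_V>0$, $a_W>0$, $\bar V\in L^2(0,T;L^2(\mathbb{T}^d;\mathbb{R}^d))$, $\bar W\in L^2(0,T;L^2(\mathbb{T}^d;\mathbb{R}^{d\times d}))$ are fixed, $\alpha$ is a fixed exponent with $0<\alpha<\frac{1}{[d/2]+4}$ ($[\cdot]$ the integer part), with $0^\alpha=0$, repeated indices are summed from $1$ to $d$, and $\partial_i$, $\nabla$, $\Delta$ act in the space variable; $\Delta^{-1}$ is the inverse Laplacian on mean-zero functions/distributions on $\mathbb{T}^d$. For $\nu\ge0$, $\mathcal{EB}\Psi^\nu_{2,\infty,2}$ is the class of all triples $(\mathbb{E},B,\chi)$ in $L^2\times L^\infty\times L^2$ on $[0,T]\times\mathbb{T}^d$, with $\mathbb{E}$ valued in $\mathbb{R}^d$ and $B,\chi$ valued in symmetric $d\times d$ matrices, satisfying weakly, together with $B(T,\cdot)\equiv0$, $$\partial_tB_{ij}=\tfrac12(\partial_j\mathbb{E}_i+\partial_i\mathbb{E}_j)-\partial_i\partial_j\Delta^{-1}(\partial_l\mathbb{E}_l-2\nu\,\partial_l\partial_k\chi_{lk})-\nu(\partial_j\partial_l\chi_{li}+\partial_i\partial_l\chi_{lj}),$$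 that is, for every smooth symmetric-matrix-valued $\psi$ on $[0,T]\times\mathbb{T}^d$ with $\psi(0,\cdot)=0$, $$-\int_0^T\!\!\int_{\mathbb{T}^d}B_{ij}\partial_t\psi_{ij}=\int_0^T\!\!\int_{\mathbb{T}^d}\Big(-\mathbb{E}_i\partial_j\psi_{ij}+\mathbb{E}_l\partial_l\Delta^{-1}\partial_i\partial_j\psi_{ij}+2\nu\chi_{lk}\partial_l\partial_k\Delta^{-1}\partial_i\partial_j\psi_{ij}-2\nu\chi_{li}\partial_l\partial_j\psi_{ij}\Big).$$ With $\|\cdot\|$ the $L^2(0,T;L^2(\mathbb{T}^d))$ norm (time-independent $V_0,\nabla V_0$ being viewed as functions of $(t,x)$) and $a_\nu:=a_V+\nu^\alpha$, set $$b_{\mathbb{E}}(\nu)=\tfrac85a_\nu^2(3+d)\|\bar V\|^2+\tfrac{56}5d\,a_Wa_\nu\|\bar W\|^2+\tfrac{64}5d^2a_\nu^2\|V_0\|^2+\tfrac{128}5d\,a_\nu a_W\nu^2\|\nabla V_0\|^2+\tfrac{12a_\nu^3}{5a_W}(d-1)^2d^2|\mathbb{T}^d|T,$$ $$b_\chi(\nu)=\tfrac{2(3+d)}d a_\nu a_W\|\bar V\|^2+14a_W^2\|\bar W\|^2+16d\,a_\nu a_W\|V_0\|^2+32a_W^2\nu^2\|\nabla V_0\|^2+3a_\nu^2(d-1)^2d\,|\mathbb{T}^d|T,$$ $$b_B(\nu)=\sqrt d\,\tfrac{d-1}2a_\nu,$$ and $\mathfrak{B}(\nu_0)=\{(\mathbb{E},B,\chi)\in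 L^2\times L^\infty\times L^2:\ \|\mathbb{E}\|^2\le b_{\mathbb{E}}(\nu_0),\ \|\chi\|^2\le b_\chi(\nu_0),\ \||B|\|_{L^\infty}\le b_B(\nu_0)\}$, where $|B|$ is the pointwise Frobenius norm. The space $\widetilde{\mathcal{EB}\Psi_{2,\infty,2}}^{w}(\nu_0):=\big(\bigcup_{\nu\ge0}\mathcal{EB}\Psi^\nu_{2,\infty,2}\big)\cap\mathfrak{B}(\nu_0)$ is endowed with the weak topology of $L^2(0,T;L^2)$ for the $\mathbb{E}$ and $\chi$ components and the weak-* topology of $L^\infty(0,T;L^\infty)$ for the $B$ component; since the set is bounded, this topology is metrizable and the space is regarded as a metric space. For $\mathbb{E}\in L^2([0,T]\times\mathbb{T}^d;\mathbb{R}^d)$ and a bounded symmetric-matrix field $N$, define $$\mathcal{M}[\mathbb{E},N]:=\sup_{M\ge Z\otimes Z}\ \frac12\int_0^T\!\!\int_{\mathbb{T}^d}2\mathbb{E}_iZ^i-N_{ij}M^{ij}\,dx\,dt\in[0,+\infty],$$ the supremum over all continuous $Z:[0,T]\times\mathbb{T}^d\to\mathbb{R}^d$ and continuous symmetric-matrix-valued $M$ with $Z\otimes Z\le M$ (formally $\mathcal{M}[\mathbb{E},N]=\frac12\int_0^T\!\int_{\mathbb{T}^d}\mathbb{E}_i(N^{-1})^{ij}\mathbb{E}_j$). With $N(a,B):=a\,\mathrm{Id}+2B$, for $\nu\ge0$, $$\mathcal{A}^\nu_{NS}(\mathbb{E},B,\chi):=\mathcal{M}\big[\mathbb{E}-(a_V+\nu^\alpha)\bar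 V,\,N(a_V+\nu^\alpha,B)\big]+\int_0^T\!\!\int_{\mathbb{T}^d}\big(V_0^i\mathbb{E}_i+2\nu\,\partial_lV_0^i\chi_{il}\big)\,dx\,dt$$ $$+\int_0^T\!\!\int_{\mathbb{T}^d}\frac1{2a_W}|\chi-B-a_W\bar W|^2\,dx\,dt-\int_0^T\!\!\int_{\mathbb{T}^d}\frac{a_V+\nu^\alpha}{2}|\bar V|^2+\frac{a_W}{2}|\bar W|^2\,dx\,dt$$ ($|\cdot|$ the Euclidean/Frobenius norm), and $\widetilde{\mathcal{A}^\nu_{NS}}$ equals $\mathcal{A}^\nu_{NS}$ on $\mathcal{EB}\Psi^\nu_{2,\infty,2}$ and $+\infty$ on $\big(\bigcup_{\nu'\ge0}\mathcal{EB}\Psi^{\nu'}_{2,\infty,2}\big)\setminus\mathcal{EB}\Psi^\nu_{2,\infty,2}$; here it is considered restricted to $\widetilde{\mathcal{EB}\Psi_{2,\infty,2}}^{w}(\nu_0)$. *)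

(* Defs.v *)
From HB Require Import structures.
From mathcomp Require Import all_boot all_order all_algebra.
From mathcomp Require Import all_classical all_reals all_analysis.
Import Order.TTheory GRing.Theory Num.Theory numFieldNormedType.Exports.

Set Implicit Arguments.
Unset Strict Implicit.
Unset Printing Implicit Defensive.

Local Open Scope classical_set_scope.
Local Open Scope ring_scope.

(* Conventions.  A point of [0,T] x T^d is a pair z = (t, x) in R * 'rV_d.
   Measurable fields on the torus are functions on R^d of which only the
   restriction to the fundamental domain [0,1]^d matters (the measures below
   are carried by it); continuous and smooth fields on the torus are
   Z^d-periodic functions on R^d.  Elements of L^p spaces are represented by
   Borel measurable functions, everywhere symmetric when they are valued in
   symmetric matrices; the functionals, the weak equation, the norms and the
   topology below do not depend on the representative. *)

Definition measure_rV_display : measure_display.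
Proof. exact: default_measure_display. Qed.

(* The sigma-algebra generated by the coordinates, i.e. the Borel one. *)
Section measurable_rV.
Context {R : realType} (n : nat).

Let coord (i : 'I_n) (x : 'rV[R]_n) : R := x 0 i.

Let rV_set0 : g_sigma_preimage coord set0.
Proof. exact: sigma_algebra0. Qed.

Let rV_setC A : g_sigma_preimage coord A -> g_sigma_preimage coord (~` A).
Proof. exact: sigma_algebraC. Qed.

Let rV_bigcup (F : (set 'rV[R]_n)^nat) :
  (forall i, g_sigma_preimage coord (F i)) ->
  g_sigma_preimage coord (\bigcup_i (F i)).
Proof. exact: sigma_algebra_bigcup. Qed.

HB.instance Definition _ := @isMeasurable.Build measure_rV_display
  'rV[R]_n (g_sigma_preimage coord) rV_set0 rV_setC rV_bigcup.

End measurable_rV.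

Lemma measurable_fun_rV (R : realType) n d (T : measurableType d)
    (f : T -> 'rV[R]_n) :
  (forall i, measurable_fun [set: T] (fun x => f x 0 i)) ->
  measurable_fun [set: T] f.
Proof.
move=> mf.
have H : g_sigma_preimage (fun i x => f x 0 i) `<=` measurable.
  apply: smallest_sub; first exact: sigma_algebra_measurable.
  case: n f mf => [|n] f mf; first by rewrite big_ord0.
  rewrite -bigcup_mkord_ord; apply: bigcup_sub => i Ii A [B mB <-]; exact: mf.
rewrite (_ : (fun i x => f x 0 i)
           = (fun i => (fun x : 'rV[R]_n => x 0 i) \o f)) // in H.
rewrite g_sigma_preimage_comp in H.
by move=> _ A mA; apply: H; exists A.
Qed.

Lemma measurable_coord_rV (R : realType) n (i : 'I_n) :
  measurable_fun [set: 'rV[R]_n] (fun x : 'rV[R]_n => x 0 i).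
Proof.
move=> _ Y mY; rewrite setTI; apply: sub_sigma_algebra => /=.
rewrite -bigcup_seq/=; exists i => /=; first by rewrite mem_index_enum.
by exists Y => //; rewrite setTI.
Qed.

Section torus_measure.
Context {R : realType}.

Definition unit_interval_measure : set (measurableTypeR R) -> \bar R :=
  mrestr (@lebesgue_measure R) (measurable_itv `[(0:R), 1]).

HB.instance Definition _ := Measure.on unit_interval_measure.

Let unit_interval_measureT : unit_interval_measure [set: _] = 1%E.
Proof.
rewrite /unit_interval_measure /mrestr setTI lebesgue_measure_itv /=.
by rewrite lte_fin ltr01 oppr0 adde0.
Qed.

HB.instance Definition _ := Measure_isProbability.Build _ _ _
  unit_interval_measure unit_interval_measureT.

Definition rV_cons n (p : measurableTypeR R * 'rV[R]_n) : 'rV[R]_n.+1 :=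
  \row_i (if unlift ord0 i is Some j then p.2 0 j else p.1).

Lemma measurable_rV_cons n : measurable_fun setT (@rV_cons n).
Proof.
apply: measurable_fun_rV => i.
under eq_fun do rewrite mxE.
case: unliftP => [j|] _; last exact: measurable_fst.
exact: (measurableT_comp (@measurable_coord_rV R n j) measurable_snd).
Qed.

HB.instance Definition _ n := isMeasurableFun.Build _ _ _ _
  (@rV_cons n) (@measurable_rV_cons n).

(* Lebesgue measure of [0,1]^n, seen as a measure on R^n. *)
Fixpoint torus_measure n : probability 'rV[R]_n R :=
  match n with
  | 0 => [the probability _ _ of \d_(0 : 'rV[R]_0)]
  | n'.+1 => [the probability _ _ of
      distribution [the probability _ _ of
        (unit_interval_measure \x torus_measure n')%E] (@rV_cons n')]
  end.

Let time_fin (T : R) : (@lebesgue_measure R `[0%R, T]%classic < +oo)%E.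
Proof.
by rewrite lebesgue_measure_itv/=; case: ifPn => // _; rewrite -EFinB ltry.
Qed.

(* Lebesgue measure restricted to [0,T]. *)
Definition time_measure (T : R) :
    {finite_measure set (measurableTypeR R) -> \bar R} :=
  [the {finite_measure set _ -> \bar R} of
    @mfrestr _ (measurableTypeR R) R _ (@lebesgue_measure R)
      (measurable_itv `[(0:R), T]) (time_fin T)].

Definition QT_measure (d : nat) (T : R) :
    {measure set (measurableTypeR R * 'rV[R]_d) -> \bar R} :=
  (time_measure T \x torus_measure d)%E.

End torus_measure.

Section fields.
Context {R : realType}.

Definition mxdot m n (A B : 'M[R]_(m, n)) : R := \sum_i \sum_j A i j * B i j.

(* Euclidean norm of row vectors, Frobenius norm of matrices. *)
Definition frob m n (A : 'M[R]_(m, n)) : R := Num.sqrt (mxdot A A).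

Definition in_Lp dp (X : measurableType dp) (mu : {measure set X -> \bar R})
    (p : \bar R) m n (f : X -> 'M[R]_(m, n)) : Prop :=
  forall i j, (fun z => f z i j) \in Lfun mu p.

Definition symmetric_field (X : Type) n (f : X -> 'M[R]_n) : Prop :=
  forall z, (f z)^T = f z.

(* C^oo: all iterated directional derivatives exist and are continuous. *)
Definition smooth (V : normedModType R) (f : V -> R) : Prop :=
  forall vs : seq V, let g := foldr (fun v (h : V -> R) => 'D_v h) f vs in
    continuous g /\ (forall z v, derivable g z v).

Context {d : nat}.

Definition dx (i : 'I_d) (f : 'rV[R]_d -> R) : 'rV[R]_d -> R :=
  'D_(delta_mx 0 i : 'rV[R]_d) f.

Definition periodic (U : Type) (f : 'rV[R]_d -> U) : Prop :=
  forall (x : 'rV[R]_d) (i : 'I_d), f (x + delta_mx 0 i) = f x.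

Local Notation Q := (R * 'rV[R]_d)%type.

Definition Dt (f : Q -> R) : Q -> R := 'D_((1, 0) : Q) f.

Definition Dx (i : 'I_d) (f : Q -> R) : Q -> R :=
  'D_((0, delta_mx 0 i) : Q) f.

Definition x_periodic (U : Type) (f : Q -> U) : Prop :=
  forall t, periodic (fun x => f (t, x)).

(* The graph of Delta^{-1} (in the space variable, t being a parameter): for
   smooth periodic f of zero spatial mean there is exactly one such p, so that
   quantifying over p below amounts to naming it. *)
Definition is_inverse_Laplacian (f p : Q -> R) : Prop :=
  [/\ smooth p, x_periodic p,
      forall t, (\int[torus_measure d]_x p (t, x)) = 0 &
      forall z, \sum_i Dx i (Dx i p) z = f z].

(* Weak gradient on the torus: G x i l is the derivative of the i-th component
   along the l-th coordinate. *)
Definition weak_gradient (V : 'rV[R]_d -> 'rV[R]_d) (G : 'rV[R]_d -> 'M[R]_d) :=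
  forall phi : 'rV[R]_d -> R, smooth phi -> periodic phi -> forall i l,
    (\int[torus_measure d]_x (V x 0 i * dx l phi x)) =
    - (\int[torus_measure d]_x (G x i l * phi x)).

Definition weakly_divergence_free (V : 'rV[R]_d -> 'rV[R]_d) :=
  forall phi : 'rV[R]_d -> R, smooth phi -> periodic phi ->
    (\int[torus_measure d]_x (\sum_i V x 0 i * dx i phi x)) = 0.

Definition zero_mean (V : 'rV[R]_d -> 'rV[R]_d) :=
  forall i, (\int[torus_measure d]_x V x 0 i) = 0.

End fields.

(* Gamma-convergence, in its sequential form for metrizable spaces: of a
   sequence of functionals, then of a family F_nu as nu -> 0+. *)
Definition Gamma_cvg (R : realType) (X : topologicalType)
    (F : nat -> X -> \bar R) (F0 : X -> \bar R) : Prop :=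
  (forall (x : X) (u : nat -> X), u @ \oo --> x ->
     (F0 x <= limn_einf (fun k => F k (u k)))%E) /\
  (forall x : X, exists2 u : nat -> X, u @ \oo --> x &
     (limn_esup (fun k => F k (u k)) <= F0 x)%E).

Definition Gamma_cvg_0plus (R : realType) (X : topologicalType)
    (F : R -> X -> \bar R) (F0 : X -> \bar R) : Prop :=
  forall nu_ : nat -> R, (forall k, 0 < nu_ k) -> nu_ @ \oo --> (0 : R) ->
    Gamma_cvg (fun k => F (nu_ k)) F0.

Section ballistic.
Context {R : realType} {d : nat}.
Local Notation Q := (R * 'rV[R]_d)%type.
Variable T : R.
Local Notation mu := (QT_measure d T).

Definition triple : Type :=
  ((Q -> 'rV[R]_d) * (Q -> 'M[R]_d) * (Q -> 'M[R]_d))%type.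

HB.instance Definition _ := Choice.on triple.

Definition uE (u : triple) : Q -> 'rV[R]_d := u.1.1.
Definition uB (u : triple) : Q -> 'M[R]_d := u.1.2.
Definition uchi (u : triple) : Q -> 'M[R]_d := u.2.

(* Test fields are smooth on R x T^d; those on [0,T] x T^d are their
   restrictions. *)
Definition EB_weak (nu : R) (u : triple) : Prop :=
  forall (psi : Q -> 'M[R]_d) (p : Q -> R),
    (forall i j, smooth (fun z => psi z i j)) ->
    x_periodic psi -> symmetric_field psi ->
    (forall x, psi (0, x) = 0) ->
    is_inverse_Laplacian
      (fun z => \sum_i \sum_j Dx i (Dx j (fun y => psi y i j)) z) p ->
  - (\int[mu]_z (\sum_i \sum_j uB u z i j * Dt (fun y => psi y i j) z)) =
  (\int[mu]_z
    (- (\sum_i \sum_j uE u z 0 i * Dx j (fun y => psi y i j) z)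
     + (\sum_l uE u z 0 l * Dx l p z)
     + 2 * nu * (\sum_l \sum_k uchi u z l k * Dx l (Dx k p) z)
     - 2 * nu * (\sum_i \sum_j \sum_l
         uchi u z l i * Dx l (Dx j (fun y => psi y i j)) z))).

Definition EBPsi (nu : R) (u : triple) : Prop :=
  [/\ in_Lp mu 2%:E (uE u), in_Lp mu +oo%E (uB u), in_Lp mu 2%:E (uchi u),
      symmetric_field (uB u) & symmetric_field (uchi u)] /\ EB_weak nu u.

Definition normL2 m n (f : Q -> 'M[R]_(m, n)) : R :=
  fine ('N[mu]_2%:E [EFin \o (fun z => frob (f z))])%E.

(* Loewner order Z (x) Z <= M on [0,T] x T^d, where Z (x) Z = Z^T *m Z for a
   row vector Z.  Continuous fields on [0,T] x T^d are the restrictions of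
   continuous periodic fields on R x R^d. *)
Definition tensor_le (Z : Q -> 'rV[R]_d) (M : Q -> 'M[R]_d) : Prop :=
  forall t x, t \in `[0, T] -> forall v : 'rV[R]_d,
    0 <= (v *m (M (t, x) - (Z (t, x))^T *m Z (t, x)) *m v^T) 0 0.

Definition MM (E : Q -> 'rV[R]_d) (N : Q -> 'M[R]_d) : \bar R :=
  ereal_sup [set r | exists (Z : Q -> 'rV[R]_d) (M : Q -> 'M[R]_d),
    [/\ continuous Z, x_periodic Z, continuous M, x_periodic M &
        symmetric_field M] /\
    tensor_le Z M /\
    r = (2^-1 * (\int[mu]_z (2 * (\sum_i E z 0 i * Z z 0 i)
                             - \sum_i \sum_j N z i j * M z i j)))%:E].

Variables (aV aW alpha : R).
Variables (Vbar : Q -> 'rV[R]_d) (Wbar : Q -> 'M[R]_d).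
Variables (V0 : 'rV[R]_d -> 'rV[R]_d) (gV0 : 'rV[R]_d -> 'M[R]_d).

Definition a_ (nu : R) : R := aV + nu `^ alpha.

Definition NN (a : R) (B : Q -> 'M[R]_d) : Q -> 'M[R]_d :=
  fun z => a%:M + 2 *: B z.

Definition A_NS (nu : R) (u : triple) : \bar R :=
  let linear : R := \int[mu]_z
    ((\sum_i V0 z.2 0 i * uE u z 0 i)
     + 2 * nu * (\sum_i \sum_l gV0 z.2 i l * uchi u z i l)) in
  let quadratic : R := \int[mu]_z
    ((2 * aW)^-1 * frob (uchi u z - uB u z - aW *: Wbar z) ^+ 2) in
  let constant : R := \int[mu]_z
    (a_ nu / 2 * frob (Vbar z) ^+ 2 + aW / 2 * frob (Wbar z) ^+ 2) in
  (MM (fun z => (uE u z - a_ nu *: Vbar z)%R) (NN (a_ nu) (uB u))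
   + (linear + quadratic - constant)%:E)%E.

Definition A_NS_ext (nu : R) (u : triple) : \bar R :=
  if `[< EBPsi nu u >] then A_NS nu u else +oo%E.

Local Notation D := (d%:R : R).
Local Notation vol := (fine (torus_measure d [set: 'rV[R]_d]) : R).
Local Notation nV0 := (normL2 (fun z => V0 z.2)).
Local Notation ngV0 := (normL2 (fun z => gV0 z.2)).

Definition b_E (nu : R) : R :=
  8 / 5 * a_ nu ^+ 2 * (3 + D) * normL2 Vbar ^+ 2
  + 56 / 5 * D * aW * a_ nu * normL2 Wbar ^+ 2
  + 64 / 5 * D ^+ 2 * a_ nu ^+ 2 * nV0 ^+ 2
  + 128 / 5 * D * a_ nu * aW * nu ^+ 2 * ngV0 ^+ 2
  + 12 * a_ nu ^+ 3 / (5 * aW) * (D - 1) ^+ 2 * D ^+ 2 * vol * T.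

Definition b_chi (nu : R) : R :=
  2 * (3 + D) / D * a_ nu * aW * normL2 Vbar ^+ 2
  + 14 * aW ^+ 2 * normL2 Wbar ^+ 2
  + 16 * D * a_ nu * aW * nV0 ^+ 2
  + 32 * aW ^+ 2 * nu ^+ 2 * ngV0 ^+ 2
  + 3 * a_ nu ^+ 2 * (D - 1) ^+ 2 * D * vol * T.

Definition b_B (nu : R) : R := Num.sqrt D * ((D - 1) / 2) * a_ nu.

Definition in_box (nu0 : R) (u : triple) : Prop :=
  [/\ normL2 (uE u) ^+ 2 <= b_E nu0, normL2 (uchi u) ^+ 2 <= b_chi nu0 &
      ('N[mu]_+oo%E [EFin \o (fun z => frob (uB u z))] <= (b_B nu0)%:E)%E].

Definition EB_set (nu0 : R) : set triple :=
  [set u | (exists2 nu : R, 0 <= nu & EBPsi nu u) /\ in_box nu0 u].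

Definition Lp_test (p : \bar R) (m n : nat) : set (Q -> 'M[R]_(m, n)) :=
  [set f | in_Lp mu p f].
Arguments Lp_test : clear implicits.

Definition pairing m n (f g : Q -> 'M[R]_(m, n)) : R :=
  \int[mu]_z mxdot (f z) (g z).

Definition weak_eval (u : triple) :
    ({ptws Lp_test 2%:E 1 d -> R} * {ptws Lp_test 1%:E d d -> R} *
     {ptws Lp_test 2%:E d d -> R})%type :=
  (fun f => pairing (uE u) (set_val f), fun f => pairing (uB u) (set_val f),
   fun f => pairing (uchi u) (set_val f)).

(* Weak L^2 topology on the first and third components, and weak-* topology
   of L^oo = (L^1)' on the second one. *)
Definition EB_space (nu0 : R) : topologicalType :=
  initial_topology (fun u : EB_set nu0 => weak_eval (set_val u)).

Definition EB_val (nu0 : R) (u : EB_space nu0) : triple :=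
  set_val (u : EB_set nu0).

End ballistic.

(* Main.v *)
Require Import Defs.
From HB Require Import structures.
From mathcomp Require Import all_boot all_order all_algebra.
From mathcomp Require Import all_classical all_reals all_analysis.
From mathcomp Require Import measurable_realfun ess_sup_inf ring lra.
Import Order.TTheory GRing.Theory Num.Theory numFieldNormedType.Exports.
Import HBNNSimple.
Set Implicit Arguments.
Unset Strict Implicit.
Unset Printing Implicit Defensive.
Local Open Scope classical_set_scope.
Local Open Scope ring_scope.

(* Lower bound: the weak equation passes to the limit, the duality term is a
   supremum of functionals that are affine in (E, B) with coefficients
   continuous in nu, and the quadratic term is bounded below by its
   linearization |a|^2 >= 2 a.b - |b|^2 at the limit.

   Recovery sequence: the equation depends on (E, chi) only through
   E - 2 nu div chi.  Given a solution (E, B, chi) at nu = 0 and a smoothing X of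
   (1 - eps) chi, the triple ((1 - eps) E + 2 nu div X, (1 - eps) B, X) solves the
   equation at nu; the factor 1 - eps leaves room in the box for the corrections.
   The duality term is jointly convex and homogeneous, and with
   c = a_nu - (1 - eps) a_V one has
     N(a_nu, (1 - eps) B) = (1 - eps) N(a_V, B) + c Id,
   so the perturbation costs at most c |Vbar|^2 + 4 nu^2 |div X|^2 / c, which
   tends to 0 along a diagonal sequence.  This needs only that functions with
   square-integrable weak space derivatives are dense in L^2, which follows from
   Dynkin's pi-lambda theorem applied to the sets {g <> 0} with g of class C^1
   in space. *)

(** * Square-integrable functions *)

(** Two obstacles shape the upper bound. First, [chi] is only square-integrable, so [2 nu div chi]
    need not be an L^2 field; it must be smoothed, and as [|div X|] may blow up when [X] approaches
    [chi], the smoothing has to be slaved to [nu]. Second, [a_V Id + 2 B] may degenerate, and then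
    the duality term is not continuous in [E], however small the perturbation; the multiple [c Id]
    gained by the scaling pays for it. One condition serves both the box and the duality term. By
    convexity of the squared norm, written on [(1 - eps) f + eps (g / eps)], a correction [g] with
    [|g|^2 <= eps^2 b] preserves the bound [b]. Since [a_nu >= a_V], also [c >= eps a_V]; with
    [b <= 1], asking [|2 nu div X|^2 <= eps^2 b] bounds the duality cost [|2 nu div X|^2 / c] by
    [eps / a_V]. A positive [b] exists even for zero data, because the last terms of [b_E] and
    [b_chi] are positive when [d >= 2]. The density argument avoids mollifiers: functions of class
    C^1 in space that vanish on the faces of the unit cube have weak derivatives against periodic
    test functions without being periodic themselves. *)

Section square_integrable.
Context dp (X : measurableType dp) (R : realType).
Variable mu : {measure set X -> \bar R}.
Hypothesis muT : mu [set: X] \is a fin_num.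
Implicit Types f g h : X -> R.

Lemma L2_measurable f : f \in Lfun mu 2%:E -> measurable_fun setT f.
Proof. by rewrite inE => /andP[]; rewrite inE. Qed.

Lemma L2_integrableM f g : f \in Lfun mu 2%:E -> g \in Lfun mu 2%:E ->
  mu.-integrable setT (EFin \o (fun x => f x * g x)).
Proof. by move=> f2 g2; apply/Lfun1_integrable; exact: Lfun2_mul_Lfun1. Qed.

Lemma integrable_sqr_L2 f : measurable_fun setT f ->
  mu.-integrable setT (EFin \o (fun x => f x ^+ 2)) -> f \in Lfun mu 2%:E.
Proof.
move=> mf /integrableP[_ fi]; rewrite inE; apply/andP; split; rewrite inE//=.
rewrite /finite_norm unlock /Lnorm poweR_lty//.
apply: le_lt_trans fi; apply: ge0_le_integral => //=.
- apply/measurable_EFinP.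
  apply: (@measurableT_comp _ _ _ _ _ _ (fun x : R => x `^ 2)%R) => //.
  exact: measurableT_comp.
- by apply/measurable_EFinP; apply: measurableT_comp => //; exact: measurable_funX.
by move=> x _; rewrite lee_fin powR_mulrn// normrX.
Qed.

Lemma L2D f g : f \in Lfun mu 2%:E -> g \in Lfun mu 2%:E ->
  (fun x => f x + g x) \in Lfun mu 2%:E.
Proof.
have p1 : (1 <= 2%:E :> \bar R)%E by rewrite lee1n.
by have [_] := Lfun_addr_closed mu p1; move=> H f2 g2; exact: (H _ _ f2 g2).
Qed.

Lemma L2Z (c : R) f : f \in Lfun mu 2%:E -> (fun x => c * f x) \in Lfun mu 2%:E.
Proof.
move=> f2; have r1 : 1 <= 2 :> R by rewrite ler1n.
have -> : (fun x => c * f x) = c \o* f by apply/funext => x; rewrite /= mulrC.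
exact: Lfun_scale.
Qed.

Lemma L2N f : f \in Lfun mu 2%:E -> (fun x => - f x) \in Lfun mu 2%:E.
Proof. by move=> /(L2Z (-1)); under eq_fun do rewrite mulN1r. Qed.

Lemma L2B f g : f \in Lfun mu 2%:E -> g \in Lfun mu 2%:E ->
  (fun x => f x - g x) \in Lfun mu 2%:E.
Proof. by move=> f2 g2; apply: L2D => //; exact: L2N. Qed.

Lemma L2_0 : (fun=> 0 : R) \in Lfun mu 2%:E.
Proof.
have p1 : (1 <= 2%:E :> \bar R)%E by rewrite lee1n.
by have [] := Lfun_addr_closed mu p1.
Qed.

Lemma L2_sum (I : Type) (s : seq I) (P : pred I) (F : I -> X -> R) :
  (forall i, P i -> F i \in Lfun mu 2%:E) ->
  (fun x => \sum_(i <- s | P i) F i x) \in Lfun mu 2%:E.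
Proof.
move=> F2; elim: s => [|i s IH].
  by under eq_fun do rewrite big_nil; exact: L2_0.
under eq_fun do rewrite big_cons.
have [Pi|//] := boolP (P i); apply: L2D => //; exact: F2.
Qed.

Lemma ae_bounded_L2 f (C : R) : measurable_fun setT f ->
  {ae mu, forall x, `|f x| <= C} -> f \in Lfun mu 2%:E.
Proof.
move=> mf fC.
have p1 : (1 <= 2%:E :> \bar R)%E by rewrite lee1n.
apply: (@Lfun_subset _ _ _ mu 2%:E +oo%E) => //; rewrite ?leey//.
rewrite inE; apply/andP; split; rewrite inE//=.
rewrite /finite_norm unlock /Lnorm; case: ifPn => // _.
apply: (@le_lt_trans _ _ C%:E); last exact: ltry.
apply/ess_supP; apply: filterS fC => x /=.
by rewrite lee_fin.
Qed.

Definition ip f g : R := \int[mu]_x (f x * g x).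

Lemma ipC f g : ip f g = ip g f.
Proof. by rewrite /ip; under eq_Rintegral do rewrite mulrC. Qed.

Lemma ip_ge0 f : 0 <= ip f f.
Proof. by apply: Rintegral_ge0 => x _; rewrite -expr2 sqr_ge0. Qed.

Lemma ipDl f g h : f \in Lfun mu 2%:E -> g \in Lfun mu 2%:E ->
  h \in Lfun mu 2%:E -> ip (fun x => f x + g x) h = ip f h + ip g h.
Proof.
move=> f2 g2 h2; rewrite /ip -RintegralD//; last 2 first.
- exact: L2_integrableM.
- exact: L2_integrableM.
by under eq_Rintegral do rewrite mulrDl.
Qed.

Lemma ipZl c f h : f \in Lfun mu 2%:E ->
  h \in Lfun mu 2%:E -> ip (fun x => c * f x) h = c * ip f h.
Proof.
move=> f2 h2; rewrite /ip -RintegralZl//; last exact: L2_integrableM.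
by under eq_Rintegral do rewrite -mulrA.
Qed.

Lemma ip0l h : ip (fun=> 0) h = 0.
Proof.
rewrite /ip; under eq_Rintegral do rewrite mul0r.
by rewrite /Rintegral integral0.
Qed.

Lemma ip_suml (I : Type) (s : seq I) (P : pred I) (F : I -> X -> R) h :
  (forall i, P i -> F i \in Lfun mu 2%:E) -> h \in Lfun mu 2%:E ->
  ip (fun x => \sum_(i <- s | P i) F i x) h = \sum_(i <- s | P i) ip (F i) h.
Proof.
move=> F2 h2; elim: s => [|i s IH].
  by under eq_fun do rewrite big_nil; rewrite big_nil ip0l.
rewrite big_cons -IH; under eq_fun do rewrite big_cons.
have [Pi|//] := boolP (P i); rewrite ipDl//; [exact: F2|exact: L2_sum].
Qed.

Lemma Rintegral_sum (I : Type) (s : seq I) (F : I -> X -> R) :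
  (forall i, mu.-integrable setT (EFin \o F i)) ->
  \int[mu]_x (\sum_(i <- s) F i x) = \sum_(i <- s) \int[mu]_x F i x.
Proof.
move=> iF.
suff [//] : mu.-integrable setT (EFin \o (fun x => \sum_(i <- s) F i x)) /\
  \int[mu]_x (\sum_(i <- s) F i x) = \sum_(i <- s) \int[mu]_x F i x.
elim: s => [|i s [IH1 IH2]].
  split; first by under eq_fun do rewrite /= big_nil; exact: integrable0.
  by under eq_Rintegral do rewrite big_nil; rewrite big_nil /Rintegral integral0.
have isum : mu.-integrable setT (EFin \o (fun x => F i x + \sum_(i <- s) F i x)).
  by have := integrableD measurableT (iF i) IH1.
split; first by under eq_fun do rewrite big_cons.
by under eq_Rintegral do rewrite big_cons; rewrite RintegralD// big_cons IH2.
Qed.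

(** Dominated convergence for the squared difference, with majorant [(2 h)^2], integrable because
    [h] is in L^2. *)
Lemma L2_dominated_cvg (f_ : nat -> X -> R) f h :
  (forall n, measurable_fun setT (f_ n)) -> measurable_fun setT f ->
  {ae mu, forall x, f_ n x @[n --> \oo] --> f x} -> h \in Lfun mu 2%:E ->
  (forall n x, `|f_ n x| <= h x) -> (forall x, `|f x| <= h x) ->
  ip (fun x => f x - f_ n x) (fun x => f x - f_ n x) @[n --> \oo] --> (0 : R).
Proof.
move=> mf_ mf cf h2 f_h fh.
have mF n : measurable_fun setT
    (EFin \o (fun x => (f x - f_ n x) * (f x - f_ n x))).
  by apply/measurable_EFinP; apply: measurable_funM; exact: measurable_funB.
have H := @dominated_convergence _ X R mu setT measurableT
   (fun n => EFin \o (fun x => (f x - f_ n x) * (f x - f_ n x)))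
   (EFin \o (fun=> 0 : R)) (EFin \o (fun x => (2 * h x) * (2 * h x))) mF.
suff /fine_cvg : (\int[mu]_x ((f x - f_ n x) * (f x - f_ n x))%:E)%E
    @[n --> \oo] --> (0%R)%:E by [].
have [||||_ _] := H; last by rewrite integral0.
- exact: measurable_cst.
- apply: filterS cf => x cfx _ /=.
  apply: cvg_EFin; first by near=> n.
  rewrite -[X in _ --> X](mulr0 (0 : R)).
  suff c0 : f x - f_ n x @[n --> \oo] --> (0 : R) by apply: cvgM.
  by rewrite -(subrr (f x)); apply: cvgB => //; exact: cvg_cst.
- by apply: L2_integrableM; exact: L2Z.
- apply/nearW => x n _ /=; rewrite lee_fin normrM.
  have le2 : `|f x - f_ n x| <= 2 * h x.
    rewrite (le_trans (ler_normB _ _))// mulr_natl mulr2n.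
    by rewrite lerD.
  by rewrite ler_pM.
Unshelve. all: by end_near. Qed.

Lemma sqrB_le (a b c : R) :
  (a - c) * (a - c) <= 2 * ((a - b) * (a - b)) + 2 * ((b - c) * (b - c)).
Proof. by have := sqr_ge0 (a - b - (b - c)); nra. Qed.

(** A triangle inequality for squared distances, up to a factor 2; this is why errors are split
    below into two quarters rather than two halves. *)
Lemma ip_approx_trans f g h : f \in Lfun mu 2%:E -> g \in Lfun mu 2%:E ->
  h \in Lfun mu 2%:E ->
  ip (fun x => f x - h x) (fun x => f x - h x) <=
  2 * ip (fun x => f x - g x) (fun x => f x - g x) +
  2 * ip (fun x => g x - h x) (fun x => g x - h x).
Proof.
move=> f2 g2 h2.
have i1 := L2_integrableM (L2B f2 g2) (L2B f2 g2).
have i2 := L2_integrableM (L2B g2 h2) (L2B g2 h2).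
have i3 := L2_integrableM (L2B f2 h2) (L2B f2 h2).
rewrite /ip -RintegralZl// -RintegralZl// -RintegralD//; first last.
- by have := integrableZl measurableT 2 i2.
- by have := integrableZl measurableT 2 i1.
apply: le_Rintegral => //.
- have := integrableZl measurableT 2 i2.
  have := integrableZl measurableT 2 i1.
  exact: integrableD.
by move=> x _; exact: sqrB_le.
Qed.

(** * Density of a linear space in L^2, by the pi-lambda theorem *)

Section density.
Variable W : set (X -> R).
Hypothesis WL2 : forall f, W f -> f \in Lfun mu 2%:E.
Hypothesis WD : forall f g, W f -> W g -> W (fun x => f x + g x).
Hypothesis WZ : forall (c : R) f, W f -> W (fun x => c * f x).

Definition L2_approx f := f \in Lfun mu 2%:E /\
  forall e : R, 0 < e ->
    exists2 g, W g & ip (fun x => f x - g x) (fun x => f x - g x) <= e.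

Lemma L2_approxD f g : L2_approx f -> L2_approx g ->
  L2_approx (fun x => f x + g x).
Proof.
move=> [f2 fa] [g2 ga]; split; first exact: L2D.
move=> e e0.
have [u Wu ue] := fa (e / 4) (divr_gt0 e0 (ltr0n _ 4)).
have [v Wv ve] := ga (e / 4) (divr_gt0 e0 (ltr0n _ 4)).
exists (fun x => u x + v x); first exact: WD.
have := @ip_approx_trans (fun x => f x + g x) (fun x => u x + g x)
  (fun x => u x + v x) (L2D f2 g2) (L2D (WL2 Wu) g2) (L2D (WL2 Wu) (WL2 Wv)).
have -> : (fun x => f x + g x - (u x + g x)) = (fun x => f x - u x).
  by apply/funext => x; ring.
have -> : (fun x => u x + g x - (u x + v x)) = (fun x => g x - v x).
  by apply/funext => x; ring.
by lra.
Qed.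

Lemma L2_approxZ c f : L2_approx f -> L2_approx (fun x => c * f x).
Proof.
move=> [f2 fa]; split; first exact: L2Z.
move=> e e0.
(* Dividing by [c ^+ 2 + 1] instead of [c ^+ 2] covers [c = 0]. *)
have c0 : 0 < c ^+ 2 + 1 by rewrite ltr_wpDl// sqr_ge0.
have [u Wu ue] := fa (e / (c ^+ 2 + 1)) (divr_gt0 e0 c0).
exists (fun x => c * u x); first exact: WZ.
have fu2 := L2B f2 (WL2 Wu).
have -> : (fun x => c * f x - c * u x) = (fun x => c * (f x - u x)).
  by apply/funext => x; ring.
rewrite ipZl//; last exact: L2Z.
rewrite ipC ipZl// mulrA -expr2.
have q0 := ip_ge0 (fun x => f x - u x).
move: ue; rewrite ler_pdivlMr//; set q := ip _ _ in q0 *; nra.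
Qed.

Lemma L2_approx_lim f : f \in Lfun mu 2%:E ->
  (forall e : R, 0 < e -> exists2 g, L2_approx g &
     ip (fun x => f x - g x) (fun x => f x - g x) <= e) ->
  L2_approx f.
Proof.
move=> f2 fa; split=> // e e0.
have [g [g2 ga] ge] := fa (e / 4) (divr_gt0 e0 (ltr0n _ 4)).
have [u Wu ue] := ga (e / 4) (divr_gt0 e0 (ltr0n _ 4)).
exists u => //.
have := ip_approx_trans f2 g2 (WL2 Wu); lra.
Qed.

Lemma L2_approx_cvg f (g_ : nat -> X -> R) : f \in Lfun mu 2%:E ->
  (forall n, L2_approx (g_ n)) ->
  ip (fun x => f x - g_ n x) (fun x => f x - g_ n x) @[n --> \oo] --> (0 : R) ->
  L2_approx f.
Proof.
move=> f2 ga gc; apply: L2_approx_lim => // e e0.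
have [n _ /(_ n (leqnn n)) /= ne] := cvgr_le _ gc e e0.
by exists (g_ n).
Qed.

Lemma indic_L2 (A : set X) : measurable A -> (\1_A : X -> R) \in Lfun mu 2%:E.
Proof.
move=> mA; apply: (@ae_bounded_L2 _ 1); first exact: measurable_indic.
by apply/nearW => x; rewrite indicE; case: (_ \in _); rewrite ?normr1 ?normr0.
Qed.

Variable G : set (set X).
Hypothesis GI : setI_closed G.
Hypothesis G_gen : measurable `<=` <<s G >>.
Hypothesis G_meas : G `<=` measurable.
Hypothesis GW : forall A, G A -> L2_approx \1_A.
Hypothesis WT : L2_approx (fun=> 1).

(** The measurable sets with approximable indicator form a lambda-system: linearity handles proper
    differences, dominated convergence handles increasing unions. It contains the pi-system [G],
    hence all that [G] generates. *)
Lemma L2_approx_indic (A : set X) : measurable A -> L2_approx \1_A.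
Proof.
move=> /G_gen.
have GmA : <<s G >> `<=` measurable.
  by apply: smallest_sub => //; exact: sigma_algebra_measurable.
have : <<s G >> `<=` [set A : set X | measurable A /\ L2_approx \1_A].
  apply: lambda_system_subset => //; last first.
    by move=> B GB; split; [exact: G_meas|exact: GW].
  split => //.
  - by split=> //; rewrite indicT.
  - move=> B C CB [mB aB] [mC aC]; split; first exact: measurableD.
    have -> : \1_(B `\` C) = (fun x => \1_B x + -1 * \1_C x) :> (X -> R).
      apply/funext => x; rewrite !indicE in_setD.
      have [xC|xC] := boolP (x \in C); last by rewrite andbT mulr0 addr0.
      have -> : x \in B by rewrite inE; apply: CB; rewrite -inE.
      by rewrite /= mulr1 subrr.
    by apply: L2_approxD => //; exact: L2_approxZ.
  - move=> F ndF FF.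
    have mU : measurable (\bigcup_n F n).
      by apply: bigcup_measurable => n _; have [] := FF n.
    split=> //.
    apply: (@L2_approx_cvg _ (fun n => \1_(F n))); first exact: indic_L2.
      by move=> n; have [] := FF n.
    apply: (@L2_dominated_cvg _ _ (fun=> 1)).
    + by move=> n; apply: measurable_indic; have [] := FF n.
    + exact: measurable_indic.
    + apply: aeW => x; apply: cvg_near_cst.
      have [[n _ Fnx]|Fx] := pselect ((\bigcup_n F n) x); last first.
        near=> n; rewrite !indicE !memNset// => Fnx.
        by apply: Fx; exists n.
      near=> m; rewrite !indicE !mem_set//; first by exists n.
      have nm : (n <= m)%N by near: m; exists n.
      by have /subsetPset := ndF _ _ nm; apply.
    + by case: WT.
    + by move=> n x; rewrite indicE; case: (_ \in _); rewrite ?normr1 ?normr0.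
    + by move=> x; rewrite indicE; case: (_ \in _); rewrite ?normr1 ?normr0.
by move=> /[apply] -[].
Unshelve. all: by end_near. Qed.

Lemma L2_approx_nnsfun (f : {nnsfun X >-> R}) : L2_approx (f : X -> R).
Proof.
have -> : (f : X -> R) = fun x =>
    \sum_(y <- finmap.enum_fset (fset_set (range f))) y * \1_(f @^-1` [set y]) x.
  by apply/funext => x; rewrite [LHS]fimfunE fsbig_finite.
elim: (finmap.enum_fset _) => [|y s IH].
  under eq_fun do rewrite big_nil.
  (* The empty sum is obtained as [0 * 1]. *)
  have := L2_approxZ 0 WT; congr L2_approx.
  by apply/funext => x; rewrite mul0r.
under eq_fun do rewrite big_cons; apply: L2_approxD => //.
by apply: L2_approxZ; exact: L2_approx_indic.
Qed.

(** Simple functions increase to [f], so [f] itself is the dominating function. *)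
Lemma L2_approx_ge0 f : f \in Lfun mu 2%:E -> (forall x, 0 <= f x) ->
  L2_approx f.
Proof.
move=> f2 f0; have mf := L2_measurable f2.
have mf' : measurable_fun setT (EFin \o f) by exact/measurable_EFinP.
pose g := nnsfun_approx measurableT mf'.
have cg x : g n x @[n --> \oo] --> f x.
  have /fine_cvg := @cvg_nnsfun_approx _ _ _ _ measurableT _ mf'
    (fun x _ => f0 x) x I.
  exact.
have ndg x : nondecreasing_seq (fun n => g n x).
  by move=> m n mn; have /lefP := @nd_nnsfun_approx _ _ _ _ measurableT _ mf' _ _ mn; apply.
have gf n x : g n x <= f x.
  have := @nondecreasing_cvgn_le _ _ (ndg x); rewrite (cvg_lim _ (cg x))//; apply.
  exact: cg.
apply: (@L2_approx_cvg _ g) => //.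
  by move=> n; exact: L2_approx_nnsfun.
apply: (@L2_dominated_cvg _ _ f) => //.
- exact/nearW.
- by move=> n x; rewrite ger0_norm//; exact: gf.
- by move=> x; rewrite ger0_norm.
Qed.

Lemma L2_dense f : f \in Lfun mu 2%:E -> L2_approx f.
Proof.
move=> f2; have mf := L2_measurable f2.
have -> : f = fun x => Order.max (f x) 0 + -1 * Order.max (- f x) 0.
  by apply/funext => x; rewrite mulN1r; case: (leP (f x) 0); case: (leP (- f x) 0);
   rewrite ?oppr0 ?addr0 ?add0r ?opprK//; lra.
have m0 (g : X -> R) : g \in Lfun mu 2%:E -> (fun x => Order.max (g x) 0) \in Lfun mu 2%:E.
  move=> g2; have mg := L2_measurable g2.
  apply: integrable_sqr_L2; first exact: measurable_maxr.
  have := Lfun2_integrable_sqr g2; apply: le_integrable => //.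
    apply/measurable_EFinP; apply: measurable_funX; exact: measurable_maxr.
  move=> x _ /=; rewrite lee_fin !ger0_norm ?sqr_ge0//.
  by case: (leP (g x) 0); rewrite // expr0n/= sqr_ge0.
apply: L2_approxD; last apply: L2_approxZ; apply: L2_approx_ge0.
- exact: m0.
- by move=> x; rewrite le_max lexx orbT.
- by apply: m0; exact: L2N.
- by move=> x; rewrite le_max lexx orbT.
Qed.

End density.
End square_integrable.

(** * Continuous functions on the space-time torus *)

Section torus_support.
Context {R : realType}.

(** The open cube still has full measure, so that statements almost everywhere may ignore the faces,
    where the approximants built later vanish. *)
Definition open_cube n : set 'rV[R]_n := [set x | forall i, 0 < x 0 i < 1].

Lemma measurable_open_cube n : measurable (@open_cube n).
Proof.
have -> : @open_cube n =
    \bigcap_(i in [set: 'I_n]) ((fun x : 'rV[R]_n => x 0 i) @^-1` `]0, 1[%classic).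
  apply/seteqP; split => x /= xP.
    by move=> i _ /=; rewrite in_itv/=; exact: xP.
  by move=> i; have := xP i I; rewrite /= in_itv.
apply: fin_bigcap_measurable => // i _.
by rewrite -[X in measurable X]setTI; exact: measurable_coord_rV.
Qed.

Lemma rV_cons0 n (s : R) (x : 'rV[R]_n) : rV_cons (s, x) 0 ord0 = s.
Proof. by rewrite mxE unlift_none. Qed.

Lemma rV_consS n (s : R) (x : 'rV[R]_n) i : rV_cons (s, x) 0 (lift ord0 i) = x 0 i.
Proof. by rewrite mxE liftK. Qed.

Lemma unit_interval_measure_itv :
  @unit_interval_measure R `]0, 1[%classic = 1%E.
Proof.
rewrite /unit_interval_measure /mrestr setIidl.
  by rewrite lebesgue_measure_itv /= lte_fin ltr01 oppr0 adde0.
by apply: subset_itv; rewrite bnd_simp.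
Qed.

Lemma torus_measure_cube n : torus_measure n (@open_cube n) = 1%E.
Proof.
elim: n => [|n IH].
  by rewrite /= diracE mem_set// => -[].
transitivity ((@unit_interval_measure R \x torus_measure n)%E
  (@rV_cons R n @^-1` @open_cube n.+1)) => //.
have -> : @rV_cons R n @^-1` @open_cube n.+1 = `]0, 1[%classic `*` @open_cube n.
  apply/seteqP; split => -[s x] /=.
    move=> sx; split; first by have := sx ord0; rewrite rV_cons0 in_itv.
    by move=> i; have := sx (lift ord0 i); rewrite rV_consS.
  rewrite in_itv/= => -[s01 xP] i; case: (unliftP ord0 i) => [j ->|->].
    by rewrite rV_consS.
  by rewrite rV_cons0.
pose I01 : set (measurableTypeR R) := `]0, 1[%classic.
transitivity (unit_interval_measure I01 * torus_measure n (@open_cube n))%E.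
  by apply: product_measure1E => //; exact: measurable_open_cube.
by rewrite IH mule1 unit_interval_measure_itv.
Qed.

Lemma torus_measure_cubeC n : torus_measure n (~` @open_cube n) = 0%E.
Proof.
rewrite probability_setC; last exact: measurable_open_cube.
by rewrite torus_measure_cube subee.
Qed.

Lemma time_measure_itvC (T : R) :
  time_measure T (~` `[0, T]%classic) = 0%E.
Proof. by rewrite /= /mfrestr /mrestr setICl measure0. Qed.

Lemma time_measureT (T : R) : 0 < T -> time_measure T setT = T%:E.
Proof.
move=> T0; rewrite /= /mfrestr /mrestr setTI lebesgue_measure_itv/=.
by rewrite lte_fin T0 oppr0 adde0.
Qed.

Lemma QT_measureX d (T : R) (A : set (measurableTypeR R)) (B : set 'rV[R]_d) :
  measurable A -> measurable B ->
  QT_measure d T (A `*` B) = (time_measure T A * torus_measure d B)%E.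
Proof. by move=> mA mB; exact: product_measure1E. Qed.

Lemma QT_measureT d (T : R) : QT_measure d T setT \is a fin_num.
Proof.
rewrite -setXTT QT_measureX// probability_setT mule1.
exact: fin_num_measure.
Qed.

Lemma QT_ae d (T : R) :
  {ae QT_measure d T, forall z : measurableTypeR R * 'rV[R]_d, z.1 \in `[0, T] /\ open_cube z.2}.
Proof.
pose N : set (measurableTypeR R) := ~` `[0, T]%classic.
have mN : measurable N by exact: measurableC.
have mC : measurable (~` @open_cube d).
  by apply: measurableC; exact: (@measurable_open_cube d).
exists (N `*` setT `|` setT `*` ~` @open_cube d); split.
- by apply: measurableU; exact: measurableX.
- apply/eqP; rewrite -measure_le0.
  apply: (le_trans (@measureU2 _ _ _ _ _ _ _ _)).
  + exact: measurableX.
  + exact: measurableX.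
  have e1 : (QT_measure d T (N `*` setT) <= 0)%E.
    by rewrite QT_measureX// time_measure_itvC mul0e.
  have e2 : (QT_measure d T (setT `*` ~` @open_cube d) <= 0)%E.
    by rewrite QT_measureX// torus_measure_cubeC mule0.
  by rewrite -[leRHS]adde0; exact: leeD e1 e2.
- move=> [t x] /= /not_andP[tT|xP]; [left|right]; split => //=.
Qed.

End torus_support.

(** * Measurability and square-integrability of continuous functions *)

Section continuous_measurable.
Context {R : realType}.

Lemma ball_rV n (x y : 'rV[R]_n) (e : R) : 0 < e ->
  (forall i, `|x 0 i - y 0 i| < e) -> ball x e y.
Proof.
by move=> e0 xy; change (@mx_ball _ _ _ _ x e y); split => // i j; rewrite ord1; exact: xy.
Qed.

Lemma rat_near (x e : R) : 0 < e -> exists q : rat, `|x - ratr q| < e.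
Proof.
move=> e0; have /rat_in_itvoo[q] : x - e < x + e by lra.
by rewrite in_itv/= => /andP[q1 q2]; exists q; rewrite ltr_norml; apply/andP; split; lra.
Qed.

(** The sigma-algebra is generated by the coordinates, so open sets must be shown to belong to it:
    an open set is the union of the countably many rational boxes that it contains. *)
Lemma continuous_measurable_QT n (f : R * 'rV[R]_n -> R) :
  continuous f -> measurable_fun setT f.
Proof.
move=> /continuousP cf.
apply: (@measurability _ _ _ _ _ _ _ (RGenOInfty.measurableE R)) => _ [_ [a ->] <-].
rewrite setTI.
have oU := cf _ (@open_gt R a).
set U := f @^-1` _.
have {}oU : open U.
  rewrite (_ : U = f @^-1` [set y | a < y])//.
  by apply/seteqP; split => z; rewrite /U /= in_itv/= andbT.
(* A box is coded by a rational centre [q.1] and the radius [1 / (q.2 + 1)]. *)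
pose box (q : rat * 'rV[rat]_n * nat) : set (R * 'rV[R]_n) :=
  [set z : R * 'rV[R]_n | `|z.1 - ratr q.1.1| < q.2.+1%:R^-1 /\
           forall i, `|z.2 0 i - ratr (q.1.2 0 i)| < q.2.+1%:R^-1].
have mbox q : measurable (box q).
  have -> : box q = (fun z => `|z.1 - ratr q.1.1|) @^-1` `]-oo, q.2.+1%:R^-1[ `&`
    \bigcap_(i in [set: 'I_n])
    ((fun z : R * 'rV[R]_n => `|z.2 0 i - ratr (q.1.2 0 i)|) @^-1` `]-oo, q.2.+1%:R^-1[).
    apply/seteqP; split => z.
      move=> [z1 z2]; split; first by rewrite /= in_itv.
      by move=> i _ /=; rewrite in_itv/=.
    move=> [/=]; rewrite in_itv/= => z1 z2; split=> // i.
    by have := z2 i I; rewrite /= in_itv.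
  apply: measurableI.
    rewrite -[X in measurable X]setTI.
    have mf : measurable_fun setT (fun z : R * 'rV[R]_n => `|z.1 - ratr q.1.1|).
      apply: measurableT_comp => //.
      by apply: measurable_funB => //; exact: measurable_fst.
    exact: mf.
  apply: fin_bigcap_measurable => // i _.
  rewrite -[X in measurable X]setTI.
  have mf : measurable_fun setT
      (fun z : R * 'rV[R]_n => `|z.2 0 i - ratr (q.1.2 0 i)|).
    apply: measurableT_comp => //; apply: measurable_funB => //.
    exact: (measurableT_comp (@measurable_coord_rV R n i) measurable_snd).
  exact: mf.
have -> : U = \bigcup_(q in [set q | box q `<=` U]) box q.
  apply/seteqP; split => [z Uz|z [q] /= + qz]; last exact.
  have /nbhs_ballP[e /= e0 zeU] : nbhs z U by apply: open_nbhs_nbhs; split.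
  (* Two points of a box are less than two radii apart in each coordinate; a radius below [e / 2]
     thus keeps every box through [z] inside the ball. *)
  have [m me] : exists m : nat, m.+1%:R^-1 < e / 2.
    have [m _ /(_ m (leqnn m)) /= h] := near_infty_natSinv_lt (PosNum (divr_gt0 e0 (ltr0n _ 2))).
    by exists m.
  have m0 : 0 < m.+1%:R^-1 :> R by rewrite invr_gt0.
  have [q qz] := rat_near z.1 m0.
  have /choice[v vz] : forall i, exists r : rat, `|z.2 0 i - ratr r| < m.+1%:R^-1.
    by move=> i; exact: rat_near.
  exists (q, \row_i v i, m).
    move=> w [/= w1 w2]; apply: zeU.
    split => /=.
      rewrite /ball/= (le_lt_trans (ler_distD (ratr q) _ _))// (splitr e).
      by rewrite ltrD// ?(lt_trans qz me)// distrC (lt_trans w1 me).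
    apply: ball_rV => // i.
    rewrite (le_lt_trans (ler_distD (ratr (v i)) _ _))// (splitr e).
    have := w2 i; rewrite mxE => w2i.
    by rewrite ltrD ?(lt_trans (vz i) me)// distrC (lt_trans w2i me).
  by split => //= i; rewrite mxE.
rewrite bigcup_mkcond; apply: countable_bigcupT_measurable => //.
by move=> q; case: ifP => // _; exact: mbox.
Qed.

Lemma continuous_bounded_QT n (T : R) (f : R * 'rV[R]_n -> R) :
  continuous f -> exists C : R, forall z : R * 'rV[R]_n, z.1 \in `[0, T] ->
    (forall i, 0 <= z.2 0 i <= 1) -> `|f z| <= C.
Proof.
move=> cf.
pose K : set (R * 'rV[R]_n) :=
  `[0, T]%classic `*` [set x : 'rV[R]_n | forall i, x 0 i \in `[0, 1]%R].
have cK : compact K.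
  apply: compact_setX; first exact: segment_compact.
  exact: (@rV_compact R n (fun=> `[0, 1]%classic) (fun=> @segment_compact R 0 1)).
have /compact_bounded[M [_ /(_ (M + 1))]] : compact (f @` K).
  by apply: continuous_compact => //; exact: continuous_subspaceT.
rewrite ltrDl ltr01 => /(_ isT) fM; exists (M + 1) => z zT z01.
by apply: fM; exists z => //; split => // i.
Qed.

Lemma continuous_L2 n (T : R) (f : R * 'rV[R]_n -> R) :
  continuous f -> f \in Lfun (QT_measure n T) 2%:E.
Proof.
move=> cf; have [C fC] := continuous_bounded_QT T cf.
apply: (@ae_bounded_L2 _ _ _ _ _ _ C); first exact: QT_measureT.
  exact: continuous_measurable_QT.
apply: filterS (QT_ae n T) => z [zT z01]; apply: fC => // i.
by have /andP[/ltW -> /ltW ->] := z01 i.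
Qed.

End continuous_measurable.

(** * Integration by parts on the torus *)

Section line.
Context {R : realType}.

Lemma is_derive_line (V : normedModType R) (f : V -> R) (z v : V) :
  (forall w, derivable f w v) -> forall s : R,
  is_derive s 1 (fun s => f (z + s *: v)) ('D_v f (z + s *: v)).
Proof.
move=> df s.
have E : (fun h : R => h^-1 *: (((fun s => f (z + s *: v)) \o shift s) (h *: (1 : R)) -
                       f (z + s *: v))) =
    (fun h => h^-1 *: ((f \o shift (z + s *: v)) (h *: v) - f (z + s *: v))).
  apply/funext => h /=; congr (_ *: (f _ - _)).
  by rewrite [h *: (1 : R)]mulr1 scalerDl addrCA.
split; first by have := df (z + s *: v); rewrite /derivable /= E.
by rewrite /derive E.
Qed.

Lemma integral_unit_interval (f : measurableTypeR R -> \bar R) :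
  measurable_fun setT f ->
  (\int[unit_interval_measure]_s f s = \int[lebesgue_measure]_(s in `[0%R, 1%R]) f s)%E.
Proof.
move=> mf.
pose I01 : set (measurableTypeR R) := `[0, 1]%classic.
have mI : measurable I01 by exact: measurable_itv.
rewrite -(setvU I01) integral_setU//; last 3 first.
- exact: measurableC.
- by rewrite setvU.
- by rewrite disj_set2E setICl eqxx.
rewrite null_set_integral ?add0e; last 3 first.
- exact: measurableC.
- exact: measurable_funTS.
- by rewrite /= /unit_interval_measure /mrestr setICl measure0.
apply: eq_measure_integral => A mA AI.
by rewrite /= /unit_interval_measure /mrestr setIidl.
Qed.

Lemma integral_unit_interval_primitive (F f : R -> R) : continuous f ->
  (forall s : R, is_derive s 1 F (f s)) ->
  (\int[unit_interval_measure]_s (f s)%:E = (F 1 - F 0)%:E)%E.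
Proof.
move=> cf dF.
have dF1 s : derivable F s 1 by have [] := dF s.
have cF : continuous F.
  by move=> s; apply: differentiable_continuous; apply/derivable1_diffP.
rewrite (@integral_unit_interval (EFin \o f)); last first.
  by apply/measurable_EFinP; exact: continuous_measurable_fun.
rewrite EFinB; apply: continuous_FTC2; first exact: ltr01.
- exact: continuous_subspaceT.
- split; first by move=> s _; exact: dF1.
  + by apply: cvg_at_right_filter; exact: cF.
  + by apply: cvg_at_left_filter; exact: cF.
- by move=> s _; rewrite derive1E; have [_ ->] := dF s.
Qed.

End line.

(** * Integrals of derivatives over the unit cube *)

Section torus_parts.
Context {R : realType}.

Lemma continuous_to_rV (U : topologicalType) n (f : U -> 'rV[R]_n) :
  (forall i, continuous (fun x => f x 0 i)) -> continuous f.
Proof.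
move=> cf x; apply/cvg_ballP => e e0.
have H : \forall y \near x, forall i, `|f x 0 i - f y 0 i| < e.
  by apply: filter_forall => i; have /cvgrPdist_lt/(_ e e0) := cf i x.
by apply: filterS H => y; exact: ball_rV.
Qed.

Lemma continuous_rV_cons n (s : R) :
  continuous (fun x : 'rV[R]_n => rV_cons (s, x)).
Proof.
apply: continuous_to_rV => i.
case: (unliftP ord0 i) => [j ->|->].
  have -> : (fun x : 'rV[R]_n => rV_cons (s, x) 0 (lift ord0 j)) = fun x => x 0 j.
    by apply/funext => x; rewrite rV_consS.
  exact: coord_continuous.
have -> : (fun x : 'rV[R]_n => rV_cons (s, x) 0 ord0) = fun=> s.
  by apply/funext => x; rewrite rV_cons0.
exact: cst_continuous.
Qed.

Lemma rV_cons_line n (s : R) (x : 'rV[R]_n) :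
  rV_cons (s, x) = rV_cons (0, x) + s *: delta_mx 0 ord0.
Proof.
apply/rowP => i; rewrite !mxE eqxx/=; case: (unliftP ord0 i) => [j ->|->].
  by rewrite eq_sym (negbTE (neq_lift _ _)) mulr0 addr0.
by rewrite eqxx mulr1 add0r.
Qed.

Lemma rV_cons_shift n (s h : R) (x : 'rV[R]_n) j :
  rV_cons (s, h *: delta_mx 0 j + x) =
  h *: delta_mx 0 (lift ord0 j) + rV_cons (s, x).
Proof.
apply/rowP => i; rewrite !mxE eqxx/=; case: (unliftP ord0 i) => [k ->|->].
  by rewrite !mxE eqxx/= (inj_eq (@lift_inj _ ord0)).
by rewrite (negbTE (neq_lift _ _)) mulr0 add0r.
Qed.

Lemma continuous_measurable_rV n (f : 'rV[R]_n -> R) :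
  continuous f -> measurable_fun setT f.
Proof.
move=> cf.
have cf' : continuous (f \o (snd : R * 'rV[R]_n -> _)).
  by move=> z; apply: continuous_comp; [exact: cvg_snd|exact: cf].
have mf := continuous_measurable_QT cf'.
rewrite (_ : f = (f \o snd) \o (fun x : 'rV[R]_n => (0 : R, x)))//.
apply: measurableT_comp mf _.
exact: pair1_measurable.
Qed.

Lemma continuous_integrable_torus n (f : 'rV[R]_n -> R) :
  continuous f -> (torus_measure n).-integrable setT (EFin \o f).
Proof.
move=> cf.
have [C fC] : exists C : R, forall x, open_cube x -> `|f x| <= C.
  have cf' : continuous (f \o (snd : R * 'rV[R]_n -> _)).
    by move=> z; apply: continuous_comp; [exact: cvg_snd|exact: cf].
  have [C fC] := continuous_bounded_QT 1 cf'; exists C => x x01.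
  apply: (fC (0, x)) => /=; first by rewrite in_itv/= lexx ler01.
  by move=> i; have /andP[/ltW -> /ltW ->] := x01 i.
have T1 : torus_measure n [set: 'rV[R]_n] \is a fin_num.
  by rewrite probability_setT.
have f2 : f \in Lfun (torus_measure n) 2%:E.
  apply: (@ae_bounded_L2 _ _ _ _ _ _ C) => //; first exact: continuous_measurable_rV.
  exists (~` @open_cube R n); split.
  - by apply: measurableC; exact: measurable_open_cube.
  - exact: torus_measure_cubeC.
  - by move=> x /= xC x01; apply: xC; exact: fC.
by apply/Lfun1_integrable; apply: Lfun_subset12 f2.
Qed.

Lemma integrable_rV_cons n (g : 'rV[R]_n.+1 -> R) :
  continuous g ->
  (unit_interval_measure \x torus_measure n)%E.-integrable setT
    (EFin \o (g \o @rV_cons R n)).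
Proof.
move=> cg; have := continuous_integrable_torus cg.
have mg : measurable_fun setT (EFin \o g).
  by apply/measurable_EFinP; exact: continuous_measurable_rV.
move=> /integrableP[_ ig]; apply/integrableP; split.
  exact: (measurableT_comp mg (@measurable_rV_cons R n)).
move: ig; rewrite ge0_integral_distribution//.
by apply: measurableT_comp.
Qed.

Lemma integral_torusS n (g : 'rV[R]_n.+1 -> R) : continuous g ->
  (\int[torus_measure n.+1]_x (g x)%:E =
   \int[unit_interval_measure \x torus_measure n]_p (g (rV_cons p))%:E)%E.
Proof.
move=> cg; have ig := integrable_rV_cons cg.
rewrite integral_distribution//.
by apply/measurable_EFinP; exact: continuous_measurable_rV.
Qed.

(** Induction along the recursive construction of the measure. If [l] is not the first coordinate,
    freeze the first one and use the induction hypothesis on the slice; otherwise integrate along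
    the first coordinate innermost, by the fundamental theorem of calculus. Equality is only asked
    between the faces [x_l = 0] and [x_l = 1], because [h] will be a product that is not periodic on
    the whole space. *)
Lemma torus_integral_dx n (l : 'I_n) (h : 'rV[R]_n -> R) :
  continuous h -> (forall x, derivable h x (delta_mx 0 l)) ->
  continuous (dx l h) ->
  (forall x : 'rV[R]_n, x 0 l = 0 -> h (x + delta_mx 0 l) = h x) ->
  (\int[torus_measure n]_x (dx l h x)%:E = 0)%E.
Proof.
elim: n l h => [[]//|n IH] l h ch dh cdh ph.
have ig := integrable_rV_cons cdh.
rewrite integral_torusS//.
case: (unliftP ord0 l) => [j lE|lE].
  rewrite -(@integral12_prod_meas1 _ _ _ _ _ unit_interval_measure (torus_measure n) _ ig).
  apply: integral0_eq => s _; rewrite /fubini_F.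
  pose hs x := h (rV_cons (s, x)).
  have hsE x : (fun k : R => k^-1 *: ((hs \o shift x) (k *: delta_mx 0 j) - hs x)) =
      (fun k : R => k^-1 *: ((h \o shift (rV_cons (s, x))) (k *: delta_mx 0 l)
                     - h (rV_cons (s, x)))).
    by apply/funext => k /=; rewrite /hs rV_cons_shift -lE.
  have dhs : dx j hs = fun x => dx l h (rV_cons (s, x)).
    by apply/funext => x; rewrite /dx /derive hsE.
  have cpair := @continuous_rV_cons n s.
  rewrite -[RHS](IH j hs).
  - by apply: eq_integral => x _ /=; rewrite dhs.
  - by move=> x; apply: continuous_comp; [exact: cpair|exact: ch].
  - by move=> x; rewrite /derivable hsE; exact: dh.
  - by rewrite dhs => x; apply: continuous_comp; [exact: cpair|exact: cdh].
  - move=> x x0.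
    have := ph (rV_cons (s, x)); rewrite lE rV_consS => /(_ x0).
    have := rV_cons_shift s 1 x j; rewrite !scale1r /hs => E.
    by rewrite [x + _]addrC E [rV_cons _ + _]addrC.
rewrite -(@integral21_prod_meas1 _ _ _ _ _ unit_interval_measure (torus_measure n) _ ig).
apply: integral0_eq => x _; rewrite /fubini_G.
have cline : continuous (fun s : R => rV_cons (0, x) + s *: delta_mx 0 l).
  move=> s; apply: cvgD; first exact: cvg_cst.
  exact: scalel_continuous.
have := @integral_unit_interval_primitive R
  (fun s => h (rV_cons (0, x) + s *: delta_mx 0 l))
  (fun s => dx l h (rV_cons (0, x) + s *: delta_mx 0 l)).
rewrite scale0r addr0 scale1r ph ?subrr; last by rewrite lE rV_cons0.
move=> H; rewrite -[RHS]H.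
- by apply: eq_integral => s _; rewrite [in LHS]/= (rV_cons_line s x) lE.
- by move=> s; apply: continuous_comp; [exact: cline|exact: cdh].
- by move=> s; exact: is_derive_line.
Qed.

End torus_parts.

(** * Weak space derivatives *)

Section smooth_periodic.
Context {R : realType}.

Lemma smooth_continuous (V : normedModType R) (f : V -> R) :
  smooth f -> continuous f.
Proof. by move=> /(_ [::]) []. Qed.

Lemma smooth_derivable (V : normedModType R) (f : V -> R) z v :
  smooth f -> derivable f z v.
Proof. by move=> /(_ [::]) [_]; exact. Qed.

Lemma smooth_derive (V : normedModType R) (f : V -> R) v :
  smooth f -> smooth ('D_v f).
Proof.
by move=> sf vs /=; have := sf (rcons vs v); rewrite /= foldr_rcons.
Qed.

Lemma derive_translation (V : normedModType R) (f : V -> R) (p v : V) :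
  (forall z, f (z + p) = f z) -> forall z, 'D_v f (z + p) = 'D_v f z.
Proof.
move=> fp z; rewrite /derive.
have -> // : (fun h : R => h^-1 *: ((f \o shift (z + p)) (h *: v) - f (z + p))) =
    (fun h => h^-1 *: ((f \o shift z) (h *: v) - f z)).
by apply/funext => h /=; rewrite addrA !fp.
Qed.

Context {d : nat}.
Local Notation Q := (R * 'rV[R]_d)%type.

Lemma x_periodicE (f : Q -> R) : x_periodic f <->
  forall (i : 'I_d) (z : Q), f (z + (0, delta_mx 0 i)) = f z.
Proof.
split=> [pf i [t x]|pf t x i].
  by rewrite -[RHS](pf t x i) /GRing.add/= /add_pair/= addr0.
by rewrite -[RHS](pf i (t, x)) /GRing.add/= /add_pair/= addr0.
Qed.

Lemma x_periodic_derive (f : Q -> R) v : x_periodic f -> x_periodic ('D_v f).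
Proof.
by move=> /x_periodicE pf; apply/x_periodicE => i z; exact: derive_translation.
Qed.

(** A global quadratic remainder treats the squared positive part at its kink like any other
    point. *)
Lemma is_derive_quadratic (V : normedModType R) (f : V -> R) (z v : V) (D : R) :
  (forall h : R, `|f (h *: v + z) - f z - h * D| <= h ^+ 2) -> is_derive z v f D.
Proof.
move=> fD.
have c : h^-1 *: ((f \o shift z) (h *: v) - f z) @[h --> 0^'] --> D.
  apply/cvgrPdist_lt => e e0; near=> h.
  have h0 : h != 0 by near: h; exact: nbhs_dnbhs_neq.
  have h1 : 0 < `|h| by rewrite normr_gt0.
  have he : `|h| < e by near: h; exact: dnbhs0_lt.
  apply: le_lt_trans he.
  have hh : `|h| * `|h| = h ^+ 2 by rewrite -expr2 real_normK// num_real.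
  rewrite -(ler_pM2l h1) hh -normrM.
  rewrite mulrBr [h * (_ *: _)]mulrA mulfV// mul1r -normrN opprB.
  exact: fD.
split; first by apply/cvg_ex; exists D.
exact: cvg_lim c.
Unshelve. all: by end_near. Qed.

(** Regularity in time is limited to joint continuity: only space derivatives are moved by parts. *)
Definition C1x (f : Q -> R) := continuous f /\
  forall l : 'I_d, (forall z, derivable f z (0, delta_mx 0 l)) /\ continuous (Dx l f).

Lemma C1x_cst (c : R) : C1x (fun=> c).
Proof.
split; first exact: cst_continuous.
move=> l; split; first by move=> z; exact: derivable_cst.
rewrite (_ : Dx l _ = fun=> 0); first exact: cst_continuous.
by apply/funext => z; rewrite /Dx derive_cst.
Qed.

Lemma C1x_mul f g : C1x f -> C1x g -> C1x (fun z => f z * g z).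
Proof.
move=> [cf df] [cg dg]; split; first by move=> z; apply: cvgM; [exact: cf|exact: cg].
move=> l; have [dfl cfl] := df l; have [dgl cgl] := dg l; split.
  by move=> z; apply: derivableM.
rewrite (_ : Dx l _ = fun z => f z * Dx l g z + g z * Dx l f z).
  by move=> z; apply: cvgD; apply: cvgM; [exact: cf|exact: cgl|exact: cg|exact: cfl].
by apply/funext => z; rewrite /Dx (deriveM (dfl z) (dgl z)).
Qed.

Lemma C1x_add f g : C1x f -> C1x g -> C1x (fun z => f z + g z).
Proof.
move=> [cf df] [cg dg]; split; first by move=> z; apply: cvgD; [exact: cf|exact: cg].
move=> l; have [dfl cfl] := df l; have [dgl cgl] := dg l; split.
  by move=> z; apply: derivableD.
rewrite (_ : Dx l _ = fun z => Dx l f z + Dx l g z).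
  by move=> z; apply: cvgD; [exact: cfl|exact: cgl].
by apply/funext => z; rewrite /Dx (deriveD (dfl z) (dgl z)).
Qed.

Lemma C1x_inv f : (forall z, f z != 0) -> C1x f -> C1x (fun z => (f z)^-1).
Proof.
move=> f0 [cf df]; split; first by move=> z; apply: cvgV => //; exact: cf.
move=> l; have [dfl cfl] := df l; split.
  by move=> z; apply: derivableV.
rewrite (_ : Dx l _ = fun z => - ((f z)^-1 * (f z)^-1 * Dx l f z)).
  move=> z; apply: cvgN; apply: cvgM; last exact: cfl.
  by apply: cvgM; apply: cvgV => //; exact: cf.
by apply/funext => z; rewrite /Dx (deriveV (f0 z) (dfl z)) scaleNr expr2 invfM.
Qed.

Lemma C1x_exp f n : C1x f -> C1x (fun z => f z ^+ n).
Proof.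
move=> cf; elim: n => [|n IH].
  by under eq_fun do rewrite expr0; exact: C1x_cst.
by under eq_fun do rewrite exprS; exact: C1x_mul.
Qed.

Lemma C1x_prod (I : Type) (s : seq I) (F : I -> Q -> R) :
  (forall i, C1x (F i)) -> C1x (fun z => \prod_(i <- s) F i z).
Proof.
move=> cF; elim: s => [|i s IH].
  by under eq_fun do rewrite big_nil; exact: C1x_cst.
by under eq_fun do rewrite big_cons; exact: C1x_mul.
Qed.

(** [c] stands for a coordinate, whose slope in a space direction is 0 or 1; with such a slope [a]
    the remainder at step [h * a] is still at most [h ^+ 2]. *)
Lemma C1x_affine_comp (c : Q -> R) (F F' : R -> R) : continuous c ->
  (forall l : 'I_d, exists a : bool,
     forall (h : R) z, c (h *: (0, delta_mx 0 l) + z) = c z + h * a%:R) ->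
  continuous F' ->
  (forall s h, `|F (s + h) - F s - h * F' s| <= h ^+ 2) ->
  C1x (F \o c).
Proof.
move=> cc lc cF' FF'.
have dF (s : R) : is_derive s (1 : R) F (F' s).
  by apply: is_derive_quadratic => h; rewrite [h *: _]mulr1 [h + s]addrC; exact: FF'.
have cF : continuous F.
  move=> s; apply: differentiable_continuous; apply/derivable1_diffP.
  by have [] := dF s.
split; first by move=> z; apply: continuous_comp; [exact: cc|exact: cF].
move=> l; have [a la] := lc l.
have dFc z : is_derive z ((0, delta_mx 0 l) : Q) (F \o c) (a%:R * F' (c z)).
  apply: is_derive_quadratic => h; rewrite /= la mulrA (le_trans (FF' _ _))//.
  by case: (a); rewrite ?mulr1// mulr0 expr0n/= sqr_ge0.
split; first by move=> z; have [] := dFc z.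
rewrite (_ : Dx l _ = fun z => a%:R * F' (c z)).
  move=> z; apply: cvgM; first exact: cvg_cst.
  by apply: continuous_comp; [exact: cc|exact: cF'].
by apply/funext => z; have [_ <-] := dFc z.
Qed.

Definition coord_QT (j : option 'I_d) (z : Q) : R :=
  if j is Some i then z.2 0 i else z.1.

Lemma continuous_coord_QT j : continuous (coord_QT j).
Proof.
case: j => [i|] z /=; last exact: cvg_fst.
apply: (@continuous_comp _ _ _ snd (fun x : 'rV[R]_d => x 0 i)); first exact: cvg_snd.
exact: coord_continuous.
Qed.

Lemma coord_QT_line j (l : 'I_d) : exists a : bool,
  forall (h : R) z, coord_QT j (h *: (0, delta_mx 0 l) + z) = coord_QT j z + h * a%:R.
Proof.
case: j => [i|].
  by exists (i == l) => h z; rewrite /= !mxE eqxx/= addrC.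
by exists false => h z; rewrite /= scaler0 add0r mulr0 addr0.
Qed.

Lemma C1x_coord j (a : R) : C1x (fun z => coord_QT j z - a).
Proof.
apply: (@C1x_affine_comp (coord_QT j) (fun s => s - a) (fun=> 1)).
- exact: continuous_coord_QT.
- exact: coord_QT_line.
- exact: cst_continuous.
- by move=> s h; rewrite (_ : _ - _ = 0) ?normr0 ?sqr_ge0//; ring.
Qed.

(** Squaring makes the positive part C^1 and keeps its nonvanishing set, the half-space where the
    coordinate exceeds [a]. *)
Lemma C1x_pospart_sqr j (a : R) : C1x (fun z => Num.max (coord_QT j z - a) 0 ^+ 2).
Proof.
apply: (@C1x_affine_comp (coord_QT j) (fun s => Num.max (s - a) 0 ^+ 2)
  (fun s => 2 * Num.max (s - a) 0)).
- exact: continuous_coord_QT.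
- exact: coord_QT_line.
- move=> s; apply: cvgM; first exact: cvg_cst.
  apply: (@continuous_max _ _ (fun s : R => s - a) (fun=> 0)).
    by apply: cvgB; [exact: cvg_id|exact: cvg_cst].
  exact: cvg_cst.
- move=> s h; rewrite ler_norml.
  by case: (leP (s + h - a) 0) => ?; case: (leP (s - a) 0) => ?;
    apply/andP; split; nra.
Qed.

End smooth_periodic.

(** * Weak space derivatives and their density *)

Section weak_derivative.
Context {R : realType} {d : nat}.
Variable T : R.
Local Notation Q := (R * 'rV[R]_d)%type.
Local Notation mu := (QT_measure d T).
Implicit Types f g : Q -> R.

Let muT : mu setT \is a fin_num := QT_measureT d T.

Lemma continuous_pair_l (t : R) : continuous (fun x : 'rV[R]_d => (t, x) : Q).
Proof.
move=> x U [[A B] [/= At Bx] ABU]; apply: filterS Bx => y By.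
by apply: (ABU (t, y)); split => //=; exact: nbhs_singleton.
Qed.

Lemma QT_integral_Dx (l : 'I_d) (h : Q -> R) : continuous h ->
  (forall z, derivable h z (0, delta_mx 0 l)) -> continuous (Dx l h) ->
  (forall z : Q, z.2 0 l = 0 -> h (z + (0, delta_mx 0 l)) = h z) ->
  \int[mu]_z Dx l h z = 0.
Proof.
move=> ch dh cdh ph.
have ig : mu.-integrable setT (EFin \o Dx l h).
  by apply/Lfun1_integrable; apply: Lfun_subset12 => //; exact: continuous_L2.
rewrite /Rintegral.
have := @integral12_prod_meas1 _ _ _ _ _ (time_measure T) (torus_measure d)
  (EFin \o Dx l h) ig.
move=> <-; rewrite integral0_eq// => t _; rewrite /fubini_F.
have cpair := @continuous_pair_l t.
pose ht x := h (t, x).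
have htE x : (fun k : R => k^-1 *: ((ht \o shift x) (k *: delta_mx 0 l) - ht x)) =
   (fun k : R => k^-1 *: ((h \o shift (t, x)) (k *: (0, delta_mx 0 l)) - h (t, x))).
  apply/funext => k /=; rewrite /ht.
  have -> // : k *: (0, delta_mx 0 l) + (t, x) = (t, k *: delta_mx 0 l + x).
  by rewrite /GRing.add/= /add_pair/= scaler0 add0r.
have dht : dx l ht = fun x => Dx l h (t, x).
  by apply/funext => x; rewrite /dx /Dx /derive htE.
rewrite -[RHS](@torus_integral_dx _ _ l ht).
- by apply: eq_integral => x _ /=; rewrite dht.
- by move=> x; apply: continuous_comp; [exact: cpair|exact: ch].
- by move=> x; rewrite /derivable htE; exact: dh.
- by rewrite dht => x; apply: continuous_comp; [exact: cpair|exact: cdh].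
- by move=> x x0; have := ph (t, x) x0; rewrite /GRing.add/= /add_pair/= addr0.
Qed.

(** The test functions carry no condition at the ends of the time interval, since only a space
    derivative is moved. *)
Definition weak_Dx (l : 'I_d) f g := g \in Lfun mu 2%:E /\
  forall theta : Q -> R, smooth theta -> x_periodic theta ->
    ip mu f (Dx l theta) = - ip mu g theta.

Definition weakly_Dx_derivable f := f \in Lfun mu 2%:E /\
  forall l, exists g, weak_Dx l f g.

Lemma smooth_L2 (theta : Q -> R) : smooth theta -> theta \in Lfun mu 2%:E.
Proof. by move=> /smooth_continuous; exact: continuous_L2. Qed.

Lemma weak_Dx_add l f1 f2 g1 g2 : f1 \in Lfun mu 2%:E -> f2 \in Lfun mu 2%:E ->
  weak_Dx l f1 g1 -> weak_Dx l f2 g2 ->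
  weak_Dx l (fun z => f1 z + f2 z) (fun z => g1 z + g2 z).
Proof.
move=> f12 f22 [g12 h1] [g22 h2]; split; first exact: L2D.
move=> th sth pth.
have s2 : Dx l th \in Lfun mu 2%:E by apply: smooth_L2; exact: smooth_derive.
have t2 := smooth_L2 sth.
by rewrite !ipDl// h1// h2// opprD.
Qed.

Lemma weak_Dx_scale l c f g : f \in Lfun mu 2%:E ->
  weak_Dx l f g -> weak_Dx l (fun z => c * f z) (fun z => c * g z).
Proof.
move=> f2 [g2 h]; split; first exact: L2Z.
move=> th sth pth.
have s2 : Dx l th \in Lfun mu 2%:E by apply: smooth_L2; exact: smooth_derive.
have t2 := smooth_L2 sth.
by rewrite !ipZl// h// mulrN.
Qed.

Lemma weakly_Dx_derivable_add f1 f2 : weakly_Dx_derivable f1 ->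
  weakly_Dx_derivable f2 -> weakly_Dx_derivable (fun z => f1 z + f2 z).
Proof.
move=> [f12 d1] [f22 d2]; split; first exact: L2D.
move=> l; have [g1 h1] := d1 l; have [g2 h2] := d2 l.
by exists (fun z => g1 z + g2 z); exact: weak_Dx_add.
Qed.

Lemma weakly_Dx_derivable_scale c f : weakly_Dx_derivable f ->
  weakly_Dx_derivable (fun z => c * f z).
Proof.
move=> [f2 h]; split; first exact: L2Z.
move=> l; have [g hg] := h l.
by exists (fun z => c * g z); exact: weak_Dx_scale.
Qed.

(** The product of [f] with a test function vanishes on both faces [z_l = 0] and [z_l = 1], so the
    integral of its derivative is 0 although [f] may fail to be periodic. *)
Lemma C1x_weakly_Dx_derivable f : C1x f ->
  (forall (l : 'I_d) (z : Q), z.2 0 l = 0 \/ z.2 0 l = 1 -> f z = 0) ->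
  weakly_Dx_derivable f.
Proof.
move=> [cf df] f0; have f2 : f \in Lfun mu 2%:E by exact: continuous_L2.
split => // l; have [dfl cfl] := df l.
exists (Dx l f); split; first exact: continuous_L2.
move=> th sth pth.
have cth := smooth_continuous sth.
have dth z : derivable th z (0, delta_mx 0 l) by exact: smooth_derivable.
have cdth : continuous (Dx l th) by apply: smooth_continuous; exact: smooth_derive.
apply/eqP; rewrite -addr_eq0 /ip -RintegralD//; last 2 first.
- by apply: L2_integrableM => //; exact: continuous_L2.
- by apply: L2_integrableM; exact: continuous_L2.
have hE : Dx l (fun z => f z * th z) = fun z => f z * Dx l th z + Dx l f z * th z.
  by apply/funext => z; rewrite /Dx (deriveM (dfl z) (dth z)) [th z *: _]mulrC.
rewrite -hE; apply/eqP; apply: QT_integral_Dx.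
- by move=> z; apply: cvgM; [exact: cf|exact: cth].
- by move=> z; apply: derivableM.
- rewrite hE => z; apply: cvgD; apply: cvgM;
    [exact: cf|exact: cdth|exact: cfl|exact: cth].
- move=> z z0; rewrite (f0 l z (or_introl z0)) mul0r (f0 l) ?mul0r//; right.
  by rewrite /GRing.add/= /add_pair/= mxE z0 mxE !eqxx add0r.
Qed.

(** Zero on every face and nonzero in the open cube: multiplying by it enforces the boundary
    condition and changes supports only by a null set. *)
Definition face_weight (z : Q) : R := \prod_(i < d) (z.2 0 i * (z.2 0 i - 1)).

Lemma C1x_face_weight : C1x face_weight.
Proof.
apply: C1x_prod => i; apply: C1x_mul; last exact: (C1x_coord (Some i) 1).
by have := C1x_coord (Some i) (0 : R); under eq_fun do rewrite subr0.
Qed.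

Definition C1x_support : set (set Q) :=
  [set A | exists2 g, C1x g & A = [set z | g z != 0]].

Lemma C1x_supportI : setI_closed C1x_support.
Proof.
move=> _ _ [f cf ->] [g cg ->]; exists (fun z => f z * g z); first exact: C1x_mul.
apply/seteqP; split => z /=; first by move=> [f0 g0]; rewrite mulf_neq0.
by rewrite mulf_eq0 negb_or => /andP.
Qed.

Lemma C1x_support_measurable : C1x_support `<=` measurable.
Proof.
move=> _ [g [cg _] ->].
have -> : [set z : Q | g z != 0] = g @^-1` (~` [set 0]).
  by apply/seteqP; split => z /= /eqP.
rewrite -[X in measurable X]setTI; apply: continuous_measurable_QT => //.
exact: measurableC.
Qed.

(** Half-spaces are supports of squared positive parts, so all coordinates, and with them the
    identity, are measurable for the generated sigma-algebra. *)
Lemma C1x_support_gen : (measurable : set (set Q)) `<=` <<s C1x_support >>.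
Proof.
pose G := g_sigma_algebraType C1x_support.
have mc j : measurable_fun [set: G] (fun z : G => coord_QT j z).
  apply: (@measurability _ _ _ _ _ _ _ (RGenOInfty.measurableE R)) => _ [_ [a ->] <-].
  rewrite setTI; apply: sub_sigma_algebra.
  exists (fun z => Num.max (coord_QT j z - a) 0 ^+ 2); first exact: C1x_pospart_sqr.
  apply/seteqP; split => z /=; rewrite in_itv/= andbT sqrf_eq0.
    by move=> az; rewrite max_l ?subr_eq0 ?gt_eqF// subr_ge0 ltW.
  by case: (leP (coord_QT j z - a) 0) => [|]; rewrite ?eqxx// subr_gt0.
have mid : measurable_fun [set: G] (fun z : G => (z : Q)).
  have -> : (fun z : G => (z : Q)) = fun z => (z.1, z.2) by apply/funext => -[].
  apply: measurable_fun_pair; first exact: (mc None).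
  by apply: measurable_fun_rV => i; exact: (mc (Some i)).
by move=> A mA; have := mid measurableT A mA; rewrite setTI.
Qed.

(* The approximants [1 - (1 + k^2)^-n] vanish where [k] does, in particular on
   the faces of the cube, so that no boundary term appears when integrating by
   parts. *)
Lemma C1x_support_approx A : C1x_support A ->
  L2_approx mu weakly_Dx_derivable \1_A.
Proof.
move=> GA; have mA := C1x_support_measurable GA.
case: GA mA => g cg -> mA.
pose k z := face_weight z * g z.
have ck : C1x k by apply: C1x_mul => //; exact: C1x_face_weight.
pose q z := (1 + k z ^+ 2)^-1.
have q0 z : 0 < 1 + k z ^+ 2 by rewrite ltr_wpDr// sqr_ge0.
have cq : C1x q.
  apply: C1x_inv; first by move=> z; rewrite gt_eqF.
  by apply: C1x_add; [exact: C1x_cst|exact: C1x_exp].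
have q01 z : 0 <= q z <= 1.
  by rewrite invr_ge0 ltW//= invf_le1// lerDl sqr_ge0.
pose f n z := 1 + -1 * q z ^+ n.
have cf n : C1x (f n).
  apply: C1x_add; first exact: C1x_cst.
  by apply: C1x_mul; [exact: C1x_cst|exact: C1x_exp].
have L1 : (fun=> 1 : R) \in Lfun mu 2%:E.
  by apply: continuous_L2; exact: cst_continuous.
have f01 n z : 0 <= f n z <= 1.
  rewrite /f mulN1r subr_ge0 gerBl; have /andP[a b] := q01 z.
  by rewrite exprn_ge0// exprn_ile1.
apply: (@L2_approx_cvg _ _ _ mu weakly_Dx_derivable _ _ f).
- by move=> ? [].
- exact: indic_L2.
- move=> n; split; first by apply: continuous_L2; case: (cf n).
  move=> e e0; exists (f n).
    apply: C1x_weakly_Dx_derivable => // l z zl.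
    have k0 : k z = 0.
      rewrite /k /face_weight (bigD1 l)//=.
      by case: zl => ->; rewrite ?subrr ?mul0r ?mulr0 ?mul0r.
    by rewrite /f /q k0 expr0n/= addr0 invr1 expr1n mulr1 subrr.
  by under eq_fun do rewrite subrr; rewrite ip0l ltW.
- apply: (@L2_dominated_cvg _ _ _ mu f _ (fun=> 1)) => //.
  + by move=> n; apply: continuous_measurable_QT; case: (cf n).
  + apply: filterS (QT_ae d T) => z [_ z01].
    have w0 : face_weight z != 0.
      apply/prodf_neq0 => i _; have /andP[a b] := z01 i.
      by apply: mulf_neq0; [rewrite gt_eqF|rewrite subr_eq0 lt_eqF].
    rewrite indicE; have [gz|gz] := eqVneq (g z) 0.
      rewrite memNset/=; last by rewrite gz eqxx.
      apply: cvg_near_cst; apply: nearW => n.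
      by rewrite /f /q /k gz mulr0 expr0n/= addr0 invr1 expr1n mulr1 subrr.
    rewrite mem_set//= -[X in _ --> X](addr0 1) /f.
    apply: cvgD; first exact: cvg_cst.
    rewrite -[X in _ --> X](mulr0 (-1)); apply: cvgM; first exact: cvg_cst.
    apply: cvg_expr; have /andP[a b] := q01 z; rewrite ger0_norm//.
    by rewrite invf_lt1// ltrDl exprn_even_gt0//= mulf_neq0.
  + by move=> n z; have /andP[a b] := f01 n z; rewrite ger0_norm.
  + by move=> z; rewrite indicE; case: (_ \in _); rewrite ?normr1 ?normr0.
Qed.

Lemma weakly_Dx_derivable_dense f : f \in Lfun mu 2%:E ->
  L2_approx mu weakly_Dx_derivable f.
Proof.
apply: (@L2_dense _ _ _ _ muT weakly_Dx_derivable _ _ _ C1x_support).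
- by move=> ? [].
- exact: weakly_Dx_derivable_add.
- exact: weakly_Dx_derivable_scale.
- exact: C1x_supportI.
- exact: C1x_support_gen.
- exact: C1x_support_measurable.
- exact: C1x_support_approx.
(* The constant 1 does not vanish on the faces, but it is the indicator of its own support and is
   approximated as such. *)
- rewrite -[fun=> 1]indicT; apply: C1x_support_approx.
  exists (fun=> 1); first exact: C1x_cst.
  by apply/seteqP; split => z //= _; exact: oner_neq0.
Qed.

End weak_derivative.

(** * Matrix fields and the weak topology *)

Section matrix_fields.
Context {R : realType} {d : nat}.
Variable T : R.
Local Notation Q := (R * 'rV[R]_d)%type.
Local Notation mu := (QT_measure d T).
Local Notation L2 := (in_Lp mu 2%:E).

Let muT : mu setT \is a fin_num := QT_measureT d T.

Lemma mxdotDl m n (A B C : 'M[R]_(m, n)) : mxdot (A + B) C = mxdot A C + mxdot B C.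
Proof.
rewrite /mxdot -big_split; apply: eq_bigr => i _.
by rewrite -big_split; apply: eq_bigr => j _; rewrite /= mxE mulrDl.
Qed.

Lemma mxdotZl m n c (A C : 'M[R]_(m, n)) : mxdot (c *: A) C = c * mxdot A C.
Proof.
rewrite /mxdot mulr_sumr; apply: eq_bigr => i _.
by rewrite mulr_sumr; apply: eq_bigr => j _; rewrite mxE mulrA.
Qed.

Lemma mxdotC m n (A B : 'M[R]_(m, n)) : mxdot A B = mxdot B A.
Proof. by apply: eq_bigr => i _; apply: eq_bigr => j _; rewrite mulrC. Qed.

Lemma mxdot_ge0 m n (A : 'M[R]_(m, n)) : 0 <= mxdot A A.
Proof. by apply: sumr_ge0 => i _; apply: sumr_ge0 => j _; rewrite -expr2 sqr_ge0. Qed.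

Lemma frob_sqr m n (A : 'M[R]_(m, n)) : frob A ^+ 2 = mxdot A A.
Proof. by rewrite sqr_sqrtr// mxdot_ge0. Qed.

Lemma frobZ m n c (A : 'M[R]_(m, n)) : 0 <= c -> frob (c *: A) = c * frob A.
Proof.
move=> c0; rewrite /frob mxdotZl mxdotC mxdotZl mulrA -expr2 sqrtrM ?sqr_ge0//.
by rewrite sqrtr_sqr ger0_norm.
Qed.

Lemma mxdot_row (A B : 'rV[R]_d) : mxdot A B = \sum_i A 0 i * B 0 i.
Proof. by rewrite /mxdot big_ord1. Qed.

Lemma in_Lp2D m n (f g : Q -> 'M[R]_(m, n)) : L2 f -> L2 g ->
  L2 (fun z => f z + g z).
Proof.
by move=> f2 g2 i j; under eq_fun do rewrite mxE; exact: L2D (f2 i j) (g2 i j).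
Qed.

Lemma in_Lp2Z m n c (f : Q -> 'M[R]_(m, n)) : L2 f -> L2 (fun z => c *: f z).
Proof. by move=> f2 i j; under eq_fun do rewrite mxE; exact: L2Z (f2 i j). Qed.

Lemma in_Lp2B m n (f g : Q -> 'M[R]_(m, n)) : L2 f -> L2 g ->
  L2 (fun z => f z - g z).
Proof.
move=> f2 g2; apply: in_Lp2D => //; under eq_fun do rewrite -scaleN1r.
exact: in_Lp2Z.
Qed.

Lemma in_Lp_le m n (p q : \bar R) (f : Q -> 'M[R]_(m, n)) :
  (1 <= p)%E -> (p <= q)%E -> in_Lp mu q f -> in_Lp mu p f.
Proof.
move=> p1 pq fq i j; apply: Lfun_subset (fq i j) => //; exact: le_trans pq.
Qed.

Lemma in_Lpy_2 m n (f : Q -> 'M[R]_(m, n)) : in_Lp mu +oo%E f -> L2 f.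
Proof. by apply: in_Lp_le; rewrite ?leey// lee1n. Qed.

Lemma in_Lp2_1 m n (f : Q -> 'M[R]_(m, n)) : L2 f -> in_Lp mu 1%E f.
Proof. by apply: in_Lp_le; rewrite ?lexx// lee1n. Qed.

Lemma continuous_in_Lp2 m n (f : Q -> 'M[R]_(m, n)) : continuous f -> L2 f.
Proof.
move=> cf i j; apply: continuous_L2 => z.
apply: (@continuous_comp _ _ _ f (fun A : 'M[R]_(m, n) => A i j)).
  exact: cf.
exact: coord_continuous.
Qed.

(** By Tonelli, the space-time integral of the square is the space integral times the finite mass of
    the time measure. *)
Lemma in_Lp_snd m n (f : 'rV[R]_d -> 'M[R]_(m, n)) :
  in_Lp (torus_measure d) 2%:E f -> L2 (fun z => f z.2).
Proof.
move=> f2 i j; have := f2 i j => h2.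
have mf := L2_measurable h2.
have mf' : measurable_fun setT (fun z : measurableTypeR R * 'rV[R]_d => f z.2 i j).
  exact: (measurableT_comp mf measurable_snd).
have /integrableP[_ fi] := Lfun2_integrable_sqr h2.
apply: integrable_sqr_L2 => //.
have mf2 : measurable_fun setT
    (EFin \o (fun z : measurableTypeR R * 'rV[R]_d => f z.2 i j ^+ 2)).
  by apply/measurable_EFinP; exact: measurable_funX.
apply/integrableP; split => //.
pose F (z : measurableTypeR R * 'rV[R]_d) := `|(f z.2 i j ^+ 2)%:E|%E.
have mF : measurable_fun setT F by exact: measurableT_comp.
have E := @fubini_tonelli1 _ _ _ _ _ (time_measure T) (torus_measure d) F mF
  (fun=> abse_ge0 _).
rewrite [ltLHS]E.
pose I := (\int[torus_measure d]_y `|(EFin \o (fun x => (f x i j ^+ 2)%R)) y|)%E.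
have -> : fubini_F (torus_measure d) F = cst I by [].
rewrite integral_cst// lte_mul_pinfty//; first exact: integral_ge0.
  by rewrite ge0_fin_numE// integral_ge0.
by rewrite -ge0_fin_numE//; exact: fin_num_measure.
Qed.

Lemma pairingE m n (f g : Q -> 'M[R]_(m, n)) : L2 f -> L2 g ->
  pairing T f g = \sum_i \sum_j ip mu (fun z => f z i j) (fun z => g z i j).
Proof.
move=> f2 g2; rewrite /pairing /mxdot Rintegral_sum//.
  by apply: eq_bigr => i _; rewrite Rintegral_sum// => j; exact: L2_integrableM.
move=> i; rewrite (_ : EFin \o _ =
  (fun z => \sum_j (EFin \o (fun z => (f z i j * g z i j)%R)) z)%E).
  by apply: integrable_sum => //= j _; exact: L2_integrableM.
by apply/funext => z; rewrite /= sumEFin.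
Qed.

Lemma integrable_mxdot m n (f g : Q -> 'M[R]_(m, n)) : L2 f -> L2 g ->
  mu.-integrable setT (EFin \o (fun z => mxdot (f z) (g z))).
Proof.
move=> f2 g2; rewrite (_ : EFin \o _ =
  (fun z => \sum_i \sum_j (EFin \o (fun z => (f z i j * g z i j)%R)) z)%E).
  apply: integrable_sum => //= i _; apply: integrable_sum => //= j _.
  exact: L2_integrableM.
apply/funext => z; rewrite /= /mxdot -sumEFin; apply: eq_bigr => i _.
by rewrite -sumEFin.
Qed.

Lemma pairingC m n (f g : Q -> 'M[R]_(m, n)) : pairing T f g = pairing T g f.
Proof. by rewrite /pairing; under eq_Rintegral do rewrite mxdotC. Qed.

Lemma pairing_ge0 m n (f : Q -> 'M[R]_(m, n)) : 0 <= pairing T f f.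
Proof. by apply: Rintegral_ge0 => z _; exact: mxdot_ge0. Qed.

Lemma pairingDl m n (f g h : Q -> 'M[R]_(m, n)) : L2 f -> L2 g -> L2 h ->
  pairing T (fun z => f z + g z) h = pairing T f h + pairing T g h.
Proof.
move=> f2 g2 h2; rewrite /pairing -RintegralD//; try exact: integrable_mxdot.
by under eq_Rintegral do rewrite mxdotDl.
Qed.

Lemma pairingZl m n c (f h : Q -> 'M[R]_(m, n)) : L2 f -> L2 h ->
  pairing T (fun z => c *: f z) h = c * pairing T f h.
Proof.
move=> f2 h2; rewrite /pairing -RintegralZl//; try exact: integrable_mxdot.
by under eq_Rintegral do rewrite mxdotZl.
Qed.

Lemma pairingBl m n (f g h : Q -> 'M[R]_(m, n)) : L2 f -> L2 g -> L2 h ->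
  pairing T (fun z => f z - g z) h = pairing T f h - pairing T g h.
Proof.
move=> f2 g2 h2; rewrite /pairing -RintegralB//; try exact: integrable_mxdot.
by under eq_Rintegral do rewrite mxdotDl -scaleN1r mxdotZl mulN1r.
Qed.

Lemma pairing_sqrD m n s (f g : Q -> 'M[R]_(m, n)) : L2 f -> L2 g ->
  pairing T (fun z => f z + s *: g z) (fun z => f z + s *: g z) =
  pairing T f f + 2 * s * pairing T f g + s ^+ 2 * pairing T g g.
Proof.
move=> f2 g2; have sg2 := in_Lp2Z s g2; have fsg2 := in_Lp2D f2 sg2.
rewrite pairingDl// (pairingC f) (pairingC (fun z => s *: g z)) !pairingDl//.
rewrite (pairingC f (fun z => s *: g z)) !pairingZl//.
rewrite (pairingC g (fun z => s *: g z)) !pairingZl// (pairingC g f); ring.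
Qed.

(** A substitute for Cauchy-Schwarz without square roots: expand [|f + s g|^2 >= 0] and
    [|f - s g|^2 >= 0], then divide by [2 s]. *)
Lemma pairing_small m n (f g : Q -> 'M[R]_(m, n)) (s : R) : L2 f -> L2 g ->
  0 < s -> pairing T f f <= s ^+ 2 ->
  `|pairing T f g| <= s * (1 + pairing T g g) / 2.
Proof.
move=> f2 g2 s0 fs.
have h1 := pairing_ge0 (fun z => f z + s *: g z).
have h2 := pairing_ge0 (fun z => f z + (- s) *: g z).
rewrite !pairing_sqrD// in h1 h2.
rewrite ler_norml -(ler_pM2l s0) -[X in _ && X](ler_pM2l s0).
by apply/andP; split; nra.
Qed.

Lemma in_Lp2_frob m n (f : Q -> 'M[R]_(m, n)) : L2 f ->
  (fun z => frob (f z)) \in Lfun mu 2%:E.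
Proof.
move=> f2.
have mdot : measurable_fun setT (fun z : measurableTypeR R * 'rV[R]_d => mxdot (f z) (f z)).
  by have /integrableP[/measurable_EFinP] := integrable_mxdot f2 f2.
apply: integrable_sqr_L2.
  by apply: (measurableT_comp _ mdot); exact: continuous_measurable_fun (@sqrt_continuous R).
have := integrable_mxdot f2 f2; congr (_.-integrable setT _).
by apply/funext => z /=; rewrite frob_sqr.
Qed.

Lemma normL2_sqr m n (f : Q -> 'M[R]_(m, n)) : L2 f ->
  normL2 T f ^+ 2 = pairing T f f.
Proof.
move=> f2; have ff2 := in_Lp2_frob f2.
have := @poweR_Lnorm _ _ R mu (EFin \o (fun z => frob (f z))) 2.
rewrite pnatr_eq0 => /(_ isT).
have : ('N[mu]_2%:E [EFin \o (fun z => frob (f z))] < +oo)%E.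
  by move: ff2; rewrite inE => /andP[_]; rewrite inE.
rewrite /normL2; have := @Lnorm_ge0 _ _ _ mu 2%:E (EFin \o (fun z => frob (f z))).
case: ('N[_]_ _ [_])%E => //= r r0 _.
move=> h; have -> : pairing T f f = fine (\int[mu]_z (`|frob (f z)| `^ 2)%:E)%E.
  congr fine; apply: eq_integral => z _.
  by rewrite powR_mulrn ?normr_ge0// real_normK ?num_real// frob_sqr.
by rewrite -h /= powR_mulrn.
Qed.

End matrix_fields.

(** * Sequential convergence in the weak and weak-* topologies *)

Lemma initial_cvgP (S : choiceType) (U : topologicalType) (f : S -> U)
    (u : nat -> initial_topology f) (x : initial_topology f) :
  u @ \oo --> x <-> f (u k) @[k --> \oo] --> f x.
Proof.
split=> [ux|fux A].
  apply: (@cvg_comp _ _ _ u f _ (nbhs x)) => //.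
  exact: (@initial_continuous _ _ f x).
rewrite nbhsE => -[V [[C oC CV] Vx] VA].
have nC : nbhs (f x) C by apply: open_nbhs_nbhs; split => //; rewrite -CV in Vx.
have H : \forall k \near \oo, C (f (u k)) := fux _ nC.
suff : \forall k \near \oo, A (u k) by [].
by apply: filterS H => k Ck; apply: VA; rewrite -CV.
Qed.

Lemma ptws_cvgP (I : Type) (R : realType) (v : nat -> {ptws I -> R})
    (l : {ptws I -> R}) :
  v @ \oo --> l <-> forall t, v k t @[k --> \oo] --> l t.
Proof.
split=> [/cvg_sup vl t|vl]; 
  first exact: ((@initial_cvgP _ _ (fun g : I -> R => g t) v l).1 (vl t)).
apply/cvg_sup => t.
exact: ((@initial_cvgP _ _ (fun g : I -> R => g t) v l).2 (vl t)).
Qed.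

Section space_topology.
Context {R : realType} {d : nat}.
Variables (T aV aW alpha nu0 : R).
Local Notation Q := (R * 'rV[R]_d)%type.
Variables (Vbar : Q -> 'rV[R]_d) (Wbar : Q -> 'M[R]_d).
Variables (V0 : 'rV[R]_d -> 'rV[R]_d) (gV0 : 'rV[R]_d -> 'M[R]_d).
Local Notation mu := (QT_measure d T).
Local Notation L2 := (in_Lp mu 2%:E).
Local Notation space := (EB_space T aV aW alpha Vbar Wbar V0 gV0 nu0).
Local Notation ev u := (@EB_val R d T aV aW alpha Vbar Wbar V0 gV0 nu0 u).

Definition pairings_cvg (u : nat -> triple (R:=R) (d:=d)) (x : triple (R:=R) (d:=d)) := [/\
  forall f, L2 f -> pairing T (uE (u k)) f @[k --> \oo] --> pairing T (uE x) f,
  forall f, in_Lp mu 1%E f -> pairing T (uB (u k)) f @[k --> \oo] --> pairing T (uB x) f &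
  forall f, L2 f -> pairing T (uchi (u k)) f @[k --> \oo] --> pairing T (uchi x) f].

Lemma EB_space_cvgP (u : nat -> space) (x : space) :
  u @ \oo --> x <-> pairings_cvg (fun k => ev (u k)) (ev x).
Proof.
pose w := fun v : space => weak_eval T (ev v).
have wP := initial_cvgP (u : nat -> initial_topology w) x.
rewrite wP; split=> [wux|[cE cB cchi]].
  have c1 : (fun k => (w (u k)).1) @ \oo --> (w x).1.
    by apply: (@cvg_comp _ _ _ (fun k => w (u k)) fst _ (nbhs (w x)) _ wux); exact: cvg_fst.
  have c2 : (fun k => (w (u k)).2) @ \oo --> (w x).2.
    by apply: (@cvg_comp _ _ _ (fun k => w (u k)) snd _ (nbhs (w x)) _ wux); exact: cvg_snd.
  have c11 : (fun k => (w (u k)).1.1) @ \oo --> (w x).1.1.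
    apply: (@cvg_comp _ _ _ (fun k => (w (u k)).1) fst _ (nbhs (w x).1) _ c1).
    exact: cvg_fst.
  have c12 : (fun k => (w (u k)).1.2) @ \oo --> (w x).1.2.
    apply: (@cvg_comp _ _ _ (fun k => (w (u k)).1) snd _ (nbhs (w x).1) _ c1).
    exact: cvg_snd.
  split => f ff.
  - exact: ((ptws_cvgP _ _).1 c11 (SigSub (mem_set ff))).
  - exact: ((ptws_cvgP _ _).1 c12 (SigSub (mem_set ff))).
  - exact: ((ptws_cvgP _ _).1 c2 (SigSub (mem_set ff))).
have c11 : (fun k => (w (u k)).1.1) @ \oo --> (w x).1.1.
  by apply/ptws_cvgP => f; apply: cE; exact: set_valP.
have c12 : (fun k => (w (u k)).1.2) @ \oo --> (w x).1.2.
  by apply/ptws_cvgP => f; apply: cB; exact: set_valP.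
have c2 : (fun k => (w (u k)).2) @ \oo --> (w x).2.
  by apply/ptws_cvgP => f; apply: cchi; exact: set_valP.
exact: (cvg_pair (cvg_pair c11 c12) c2).
Qed.

End space_topology.

(** * The action *)

Section functional.
Context {R : realType} {d : nat}.
Variable T : R.
Local Notation Q := (R * 'rV[R]_d)%type.
Local Notation mu := (QT_measure d T).
Local Notation L2 := (in_Lp mu 2%:E).
Local Notation triple := (triple (R:=R) (d:=d)).

Implicit Types (psi : Q -> 'M[R]_d) (p : Q -> R) (u : triple).

Definition test_Dt (psi : Q -> 'M[R]_d) : Q -> 'M[R]_d :=
  fun z => \matrix_(i, j) Dt (fun y => psi y i j) z.
Definition test_div (psi : Q -> 'M[R]_d) : Q -> 'rV[R]_d :=
  fun z => \row_i \sum_j Dx j (fun y => psi y i j) z.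
Definition test_graddiv (psi : Q -> 'M[R]_d) : Q -> 'M[R]_d :=
  fun z => \matrix_(l, i) \sum_j Dx l (Dx j (fun y => psi y i j)) z.
Definition test_grad (p : Q -> R) : Q -> 'rV[R]_d := fun z => \row_l Dx l p z.
Definition test_hess (p : Q -> R) : Q -> 'M[R]_d :=
  fun z => \matrix_(l, k) Dx l (Dx k p) z.

Lemma smooth_Dx_L2 l (f : Q -> R) : smooth f -> Dx l f \in Lfun mu 2%:E.
Proof. by move=> sf; apply: smooth_L2; exact: smooth_derive. Qed.

Lemma smooth_DxDx_L2 l k (f : Q -> R) : smooth f -> Dx l (Dx k f) \in Lfun mu 2%:E.
Proof. by move=> sf; apply: smooth_Dx_L2; exact: smooth_derive. Qed.

Lemma test_Dt_L2 psi : (forall i j, smooth (fun z => psi z i j)) -> L2 (test_Dt psi).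
Proof.
move=> sp i j; under eq_fun do rewrite mxE.
by apply: smooth_L2; exact: smooth_derive.
Qed.

Lemma test_div_L2 psi : (forall i j, smooth (fun z => psi z i j)) -> L2 (test_div psi).
Proof.
move=> sp i j; under eq_fun do rewrite mxE.
by apply: L2_sum => k _; exact: smooth_Dx_L2.
Qed.

Lemma test_graddiv_L2 psi :
  (forall i j, smooth (fun z => psi z i j)) -> L2 (test_graddiv psi).
Proof.
move=> sp i j; under eq_fun do rewrite mxE.
by apply: L2_sum => k _; exact: smooth_DxDx_L2.
Qed.

Lemma test_grad_L2 p : smooth p -> L2 (test_grad p).
Proof. by move=> sp i j; under eq_fun do rewrite mxE; exact: smooth_Dx_L2. Qed.

Lemma test_hess_L2 p : smooth p -> L2 (test_hess p).
Proof. by move=> sp i j; under eq_fun do rewrite mxE; exact: smooth_DxDx_L2. Qed.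

(** Each term is a pairing with a fixed L^2 test field, the form in which the equation passes to
    weak limits. *)
Definition weak_rhs (nu : R) (u : triple) psi p : R :=
  - pairing T (uE u) (test_div psi) + pairing T (uE u) (test_grad p)
  + 2 * nu * pairing T (uchi u) (test_hess p)
  - 2 * nu * pairing T (uchi u) (test_graddiv psi).

Lemma EB_weakP nu (u : triple) : L2 (uE u) -> L2 (uB u) -> L2 (uchi u) ->
  EB_weak T nu u <->
  forall (psi : Q -> 'M[R]_d) (p : Q -> R),
    (forall i j, smooth (fun z => psi z i j)) ->
    x_periodic psi -> symmetric_field psi -> (forall x, psi (0, x) = 0) ->
    is_inverse_Laplacian
      (fun z => \sum_i \sum_j Dx i (Dx j (fun y => psi y i j)) z) p ->
  - pairing T (uB u) (test_Dt psi) = weak_rhs nu u psi p.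
Proof.
move=> E2 B2 chi2.
suff H (psi : Q -> 'M[R]_d) (p : Q -> R) : (forall i j, smooth (fun z => psi z i j)) -> smooth p ->
  (\int[mu]_z (\sum_i \sum_j uB u z i j * Dt (fun y => psi y i j) z) =
     pairing T (uB u) (test_Dt psi)) /\
  (\int[mu]_z
    (- (\sum_i \sum_j uE u z 0 i * Dx j (fun y => psi y i j) z)
     + (\sum_l uE u z 0 l * Dx l p z)
     + 2 * nu * (\sum_l \sum_k uchi u z l k * Dx l (Dx k p) z)
     - 2 * nu * (\sum_i \sum_j \sum_l
         uchi u z l i * Dx l (Dx j (fun y => psi y i j)) z)) =
   weak_rhs nu u psi p).
  split=> W psi p sp pp symp psi0 pL; have [sp' _ _ _] := pL;
    have [e1 e2] := H psi p sp sp'.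
    by rewrite -e1 -e2; exact: W.
  by rewrite e1 e2; exact: W.
move=> sp sp'; split.
  apply: eq_Rintegral => z _; apply: eq_bigr => i _; apply: eq_bigr => j _.
  by rewrite mxE.
have i1 := integrable_mxdot E2 (test_div_L2 sp).
have i2 := integrable_mxdot E2 (test_grad_L2 sp').
have i3 := integrable_mxdot chi2 (test_hess_L2 sp').
have i4 := integrable_mxdot chi2 (test_graddiv_L2 sp).
have Z c (f : Q -> R) : mu.-integrable setT (EFin \o f) ->
    mu.-integrable setT (EFin \o (fun z => c * f z)).
  by move=> fi; have := integrableZl measurableT c fi.
have A (f g : Q -> R) : mu.-integrable setT (EFin \o f) ->
    mu.-integrable setT (EFin \o g) ->
    mu.-integrable setT (EFin \o (fun z => f z + g z)).
  by move=> fi gi; have := integrableD measurableT fi gi.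
transitivity (\int[mu]_z
   (-1 * mxdot (uE u z) (test_div psi z) + mxdot (uE u z) (test_grad p z)
    + 2 * nu * mxdot (uchi u z) (test_hess p z)
    + - (2 * nu) * mxdot (uchi u z) (test_graddiv psi z))).
  apply: eq_Rintegral => z _; rewrite mulN1r mulNr; congr (- _ + _ + _ * _ - _ * _).
  - rewrite mxdot_row; apply: eq_bigr => i _.
    by rewrite mxE mulr_sumr.
  - by rewrite mxdot_row; apply: eq_bigr => i _; rewrite mxE.
  - by apply: eq_bigr => i _; apply: eq_bigr => j _; rewrite mxE.
  - rewrite /mxdot [RHS]exchange_big; apply: eq_bigr => i _.
    under [RHS]eq_bigr do rewrite mxE mulr_sumr.
    exact: exchange_big.
have j1 := Z (-1) _ i1; have j3 := Z (2 * nu) _ i3.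
have j4 := Z (- (2 * nu)) _ i4.
have j12 := A _ _ j1 i2; have j123 := A _ _ j12 j3.
rewrite RintegralD// RintegralD// RintegralD//.
by rewrite !RintegralZl// mulN1r mulNr.
Qed.

Definition admissible (Z : Q -> 'rV[R]_d) (M : Q -> 'M[R]_d) :=
  [/\ continuous Z, x_periodic Z, continuous M, x_periodic M &
      symmetric_field M] /\ tensor_le T Z M.

Lemma admissible_L2 Z M : admissible Z M -> L2 Z /\ L2 M.
Proof.
by move=> [[cZ _ cM _ _] _]; split; exact: continuous_in_Lp2.
Qed.

Lemma MM_valueE (E Z : Q -> 'rV[R]_d) (N M : Q -> 'M[R]_d) :
  L2 E -> L2 Z -> L2 N -> L2 M ->
  2^-1 * (\int[mu]_z (2 * (\sum_i E z 0 i * Z z 0 i)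
                      - \sum_i \sum_j N z i j * M z i j)) =
  pairing T E Z - 2^-1 * pairing T N M.
Proof.
move=> E2 Z2 N2 M2.
have i1 := integrable_mxdot E2 Z2; have i2 := integrable_mxdot N2 M2.
have i1' : mu.-integrable setT (EFin \o (fun z => 2 * mxdot (E z) (Z z))).
  by have := integrableZl measurableT 2 i1.
transitivity (2^-1 * \int[mu]_z (2 * mxdot (E z) (Z z) - mxdot (N z) (M z))).
  by congr (_ * _); apply: eq_Rintegral => z _; rewrite mxdot_row.
by rewrite RintegralB// RintegralZl// mulrBr mulrA mulVf// mul1r.
Qed.

(** [MM_ge], [MM_le] and [MM_gt] are the three uses of the supremum: a competitor, a uniform bound,
    a nearly optimal competitor. *)
Lemma MM_ge (E : Q -> 'rV[R]_d) (N : Q -> 'M[R]_d) Z M : L2 E -> L2 N ->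
  admissible Z M -> ((pairing T E Z - 2^-1 * pairing T N M)%:E <= MM T E N)%E.
Proof.
move=> E2 N2 aZM; have [Z2 M2] := admissible_L2 aZM.
apply: ereal_sup_ubound; exists Z, M; case: aZM => a b; split => //; split => //.
by rewrite MM_valueE.
Qed.

Lemma MM_le (E : Q -> 'rV[R]_d) (N : Q -> 'M[R]_d) c : L2 E -> L2 N ->
  (forall Z M, admissible Z M -> ((pairing T E Z - 2^-1 * pairing T N M)%:E <= c)%E) ->
  (MM T E N <= c)%E.
Proof.
move=> E2 N2 H; apply: ge_ereal_sup => _ [Z [M [a [b ->]]]].
have aZM : admissible Z M by split.
have [Z2 M2] := admissible_L2 aZM.
by rewrite MM_valueE//; exact: H.
Qed.

Lemma MM_gt (E : Q -> 'rV[R]_d) (N : Q -> 'M[R]_d) c : L2 E -> L2 N ->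
  (c < MM T E N)%E -> exists Z M, admissible Z M /\
    (c < (pairing T E Z - 2^-1 * pairing T N M)%:E)%E.
Proof.
move=> E2 N2 /ereal_sup_gt[_ [Z [M [a [b ->]]]] cZM]; exists Z, M.
have aZM : admissible Z M by split.
have [Z2 M2] := admissible_L2 aZM.
by rewrite MM_valueE// in cZM; split.
Qed.

Lemma NN_L2 a (B : Q -> 'M[R]_d) : L2 B -> L2 (NN a B).
Proof.
move=> B2; apply: in_Lp2D; last exact: in_Lp2Z.
by apply: continuous_in_Lp2; exact: cst_continuous.
Qed.

Local Notation Id := (fun _ : Q => 1%:M : 'M[R]_d).

Lemma Id_L2 : L2 Id.
Proof. by apply: continuous_in_Lp2; exact: cst_continuous. Qed.

Lemma pairing_NN a (B M : Q -> 'M[R]_d) : L2 B -> L2 M ->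
  pairing T (NN a B) M = a * pairing T Id M + 2 * pairing T B M.
Proof.
move=> B2 M2; have Id2 := Id_L2.
rewrite -!pairingZl// -pairingDl//; try exact: in_Lp2Z.
by congr pairing; apply/funext => z; rewrite /NN scalemx1.
Qed.

End functional.

(** * The action in terms of pairings, and the limit of its coefficients *)

Section action.
Context {R : realType} {d : nat}.
Variables (T aV aW alpha : R).
Local Notation Q := (R * 'rV[R]_d)%type.
Local Notation mu := (QT_measure d T).
Local Notation L2 := (in_Lp mu 2%:E).
Local Notation triple := (triple (R:=R) (d:=d)).
Variables (Vbar : Q -> 'rV[R]_d) (Wbar : Q -> 'M[R]_d).
Variables (V0 : 'rV[R]_d -> 'rV[R]_d) (gV0 : 'rV[R]_d -> 'M[R]_d).
Local Notation V0' := (fun z : Q => V0 z.2).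
Local Notation gV0' := (fun z : Q => gV0 z.2).
Local Notation a_ := (a_ aV alpha).
Local Notation A_NS := (A_NS T aV aW alpha Vbar Wbar V0 gV0).
Local Notation A_NS_ext := (A_NS_ext T aV aW alpha Vbar Wbar V0 gV0).
Hypothesis aW0 : 0 < aW.
Hypothesis alpha0 : 0 < alpha.
Hypothesis Vbar2 : L2 Vbar.
Hypothesis Wbar2 : L2 Wbar.
Hypothesis V02 : L2 V0'.
Hypothesis gV02 : L2 gV0'.

Local Notation residual u := (fun z => uchi u z - uB u z - aW *: Wbar z).

(** The action minus its duality term, the only one that can be infinite. *)
Definition action_remainder (nu : R) (u : triple) : R :=
  pairing T (uE u) V0' + 2 * nu * pairing T (uchi u) gV0'
  + (2 * aW)^-1 * pairing T (residual u) (residual u)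
  - (a_ nu / 2 * pairing T Vbar Vbar + aW / 2 * pairing T Wbar Wbar).

Lemma residual_L2 (u : triple) : L2 (uB u) -> L2 (uchi u) -> L2 (residual u).
Proof.
by move=> B2 chi2; apply: in_Lp2B; [exact: in_Lp2B|exact: in_Lp2Z].
Qed.

Lemma A_NSE nu (u : triple) : L2 (uE u) -> L2 (uB u) -> L2 (uchi u) ->
  A_NS nu u = (MM T (fun z => (uE u z - a_ nu *: Vbar z)%R) (NN (a_ nu) (uB u))
               + (action_remainder nu u)%:E)%E.
Proof.
move=> E2 B2 chi2; congr (_ + _%:E)%E; rewrite /action_remainder.
have r2 := residual_L2 B2 chi2.
have Z c (f : Q -> R) : mu.-integrable setT (EFin \o f) ->
    mu.-integrable setT (EFin \o (fun z => c * f z)).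
  by move=> fi; have := integrableZl measurableT c fi.
have i1 := integrable_mxdot E2 V02; have i2 := integrable_mxdot chi2 gV02.
have i3 := integrable_mxdot r2 r2.
have i4 := integrable_mxdot Vbar2 Vbar2; have i5 := integrable_mxdot Wbar2 Wbar2.
congr (_ + _ - _).
- rewrite -RintegralZl// -RintegralD//; last exact: Z.
  apply: eq_Rintegral => z _; rewrite mxdotC mxdot_row.
  by rewrite (mxdotC (uchi u z)).
- by rewrite -RintegralZl//; apply: eq_Rintegral => z _; rewrite frob_sqr.
- rewrite -!RintegralZl// -RintegralD//; try exact: Z.
  by apply: eq_Rintegral => z _; rewrite !frob_sqr.
Qed.

(** Since [powR 0 0] is 1, it is [0 < alpha] that yields the convention that 0 to the power [alpha]
    is 0. *)
Lemma a_0 : a_ 0 = aV.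
Proof. by rewrite /a_ powR0 ?gt_eqF// addr0. Qed.

Lemma powR_cvg0 (nu_ : nat -> R) : (forall k, 0 < nu_ k) ->
  nu_ k @[k --> \oo] --> (0 : R) -> nu_ k `^ alpha @[k --> \oo] --> (0 : R).
Proof.
move=> nu0 nuc; apply/cvgrPdist_lt => e e0.
have e1 : 0 < e `^ alpha^-1 by exact: powR_gt0.
have /cvgrPdist_lt/(_ _ e1) := nuc; apply: filterS => k.
rewrite !sub0r !normrN !ger0_norm ?powR_ge0//; last exact: ltW.
move=> h; have -> : e = (e `^ alpha^-1) `^ alpha.
  by rewrite -powRrM mulVf ?gt_eqF// powRr1// ltW.
by apply: gt0_ltr_powR => //; rewrite nnegrE ltW.
Qed.

Lemma a_cvg (nu_ : nat -> R) : (forall k, 0 < nu_ k) ->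
  nu_ k @[k --> \oo] --> (0 : R) -> a_ (nu_ k) @[k --> \oo] --> a_ 0.
Proof.
move=> nu0 nuc; rewrite a_0 -[X in _ --> X](addr0 aV).
by apply: cvgD; [exact: cvg_cst|exact: powR_cvg0].
Qed.

End action.

(** * Lower bound *)

(** Real thresholds below [L] treat a finite and an infinite lower bound at once. *)
Lemma limn_einf_ge (R : realType) (u : nat -> \bar R) (L : \bar R) :
  (forall c : R, (c%:E < L)%E -> \forall k \near \oo, (c%:E <= u k)%E) ->
  (L <= limn_einf u)%E.
Proof.
move=> H.
have H1 (c : R) : (c%:E < L)%E -> (c%:E <= limn_einf u)%E.
  move=> /H cu; rewrite /limn_einf leeNr.
  apply: (@le_trans _ _ (ereal_sup ((\- u)%E @` [set k | (c%:E <= u k)%E]))).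
    by apply: ereal_inf_lbound; exists [set k | (c%:E <= u k)%E].
  apply: ge_ereal_sup => _ [k ck <-].
  by have h : (- u k <= - c%:E)%E by rewrite leeN2.
move: L H H1 => [r| |] _ H1; last exact: leNye.
  apply/lee_subgt0Pr => e e0; rewrite -EFinB; apply: H1.
  by rewrite lte_fin ltrBlDr ltrDl.
rewrite leye_eq; apply/eqP/eqyP => A _; apply: H1; exact: ltry.
Qed.

Lemma limn_esup_le (R : realType) (u : nat -> \bar R) (c : \bar R) :
  (forall e : R, 0 < e -> \forall k \near \oo, (u k <= c + e%:E)%E) ->
  (limn_esup u <= c)%E.
Proof.
move=> H; apply/lee_addgt0Pr => e /H ue.
apply: (@le_trans _ _ (ereal_sup (u @` [set k | (u k <= c + e%:E)%E]))).
  by apply: ereal_inf_lbound; exists [set k | (u k <= c + e%:E)%E].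
by apply: ge_ereal_sup => _ [k /= ck <-].
Qed.

Lemma weak_rhs_cvg (R : realType) (b e1 e2 x1 x2 nu : nat -> R)
    (lb l1 l2 m1 m2 n : R) :
  b k @[k --> \oo] --> lb -> e1 k @[k --> \oo] --> l1 -> e2 k @[k --> \oo] --> l2 ->
  x1 k @[k --> \oo] --> m1 -> x2 k @[k --> \oo] --> m2 -> nu k @[k --> \oo] --> n ->
  - b k - (- e1 k + e2 k + 2 * nu k * x1 k - 2 * nu k * x2 k) @[k --> \oo] -->
  - lb - (- l1 + l2 + 2 * n * m1 - 2 * n * m2).
Proof.
move=> cb c1 c2 d1 d2 cn.
have cc (r : R) : r @[k --> \oo] --> r by exact: cvg_cst.
apply: cvgB; first exact: cvgN.
apply: cvgB; last by apply: cvgM => //; exact: cvgM.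
apply: cvgD; last by apply: cvgM => //; exact: cvgM.
by apply: cvgD => //; exact: cvgN.
Qed.

Section liminf.
Context {R : realType} {d : nat}.
Variables (T aV aW alpha : R).
Local Notation Q := (R * 'rV[R]_d)%type.
Local Notation mu := (QT_measure d T).
Local Notation L2 := (in_Lp mu 2%:E).
Local Notation triple := (triple (R:=R) (d:=d)).
Variables (Vbar : Q -> 'rV[R]_d) (Wbar : Q -> 'M[R]_d).
Variables (V0 : 'rV[R]_d -> 'rV[R]_d) (gV0 : 'rV[R]_d -> 'M[R]_d).
Local Notation V0' := (fun z : Q => V0 z.2).
Local Notation gV0' := (fun z : Q => gV0 z.2).
Local Notation a_ := (a_ aV alpha).
Local Notation A_NS := (A_NS T aV aW alpha Vbar Wbar V0 gV0).
Local Notation A_NS_ext := (A_NS_ext T aV aW alpha Vbar Wbar V0 gV0).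
Hypothesis aW0 : 0 < aW.
Hypothesis alpha0 : 0 < alpha.
Hypothesis Vbar2 : L2 Vbar.
Hypothesis Wbar2 : L2 Wbar.
Hypothesis V02 : L2 V0'.
Hypothesis gV02 : L2 gV0'.
Local Notation residual u := (fun z => uchi u z - uB u z - aW *: Wbar z).
Local Notation Id := (fun _ : Q => 1%:M : 'M[R]_d).

(** For fixed [Z], [M], [Y] this is affine in [u] through finitely many pairings, hence converges
    along weakly convergent sequences, where the action is only semicontinuous. *)
Definition linearized_action (nu : R) (u : triple) Z M Y : R :=
  pairing T (uE u) Z - a_ nu * pairing T Vbar Z
  - 2^-1 * (a_ nu * pairing T Id M + 2 * pairing T (uB u) M)
  + (pairing T (uE u) V0' + 2 * nu * pairing T (uchi u) gV0'
     + (2 * aW)^-1 * (2 * (pairing T (uchi u) Y - pairing T (uB u) Y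
                           - aW * pairing T Wbar Y) - pairing T Y Y)
     - (a_ nu / 2 * pairing T Vbar Vbar + aW / 2 * pairing T Wbar Wbar)).

Lemma MM_integrandE nu (u : triple) Z M :
  L2 (uE u) -> L2 (uB u) -> L2 Z -> L2 M ->
  pairing T (fun z => uE u z - a_ nu *: Vbar z) Z
    - 2^-1 * pairing T (NN (a_ nu) (uB u)) M =
  pairing T (uE u) Z - a_ nu * pairing T Vbar Z
    - 2^-1 * (a_ nu * pairing T Id M + 2 * pairing T (uB u) M).
Proof.
move=> E2 B2 Z2 M2.
by rewrite pairingBl// ?pairingZl// ?pairing_NN//; exact: in_Lp2Z.
Qed.

Lemma shifted_E_L2 nu (u : triple) : L2 (uE u) ->
  L2 (fun z => uE u z - a_ nu *: Vbar z).
Proof. by move=> E2; apply: in_Lp2B => //; exact: in_Lp2Z. Qed.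

Lemma pairing_residual (u : triple) Y : L2 (uB u) -> L2 (uchi u) -> L2 Y ->
  pairing T (residual u) Y =
  pairing T (uchi u) Y - pairing T (uB u) Y - aW * pairing T Wbar Y.
Proof.
move=> B2 chi2 Y2.
by rewrite !pairingBl// ?pairingZl//; [exact: in_Lp2B|exact: in_Lp2Z].
Qed.

Lemma linearized_action_le nu (u : triple) Z M Y :
  L2 (uE u) -> L2 (uB u) -> L2 (uchi u) -> L2 Y -> admissible T Z M ->
  ((linearized_action nu u Z M Y)%:E <= A_NS nu u)%E.
Proof.
move=> E2 B2 chi2 Y2 aZM; have [Z2 M2] := admissible_L2 aZM.
rewrite A_NSE// EFinD; apply: leeD.
  rewrite -MM_integrandE//; apply: MM_ge => //; first exact: shifted_E_L2.
  exact: NN_L2.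
rewrite lee_fin /action_remainder lerD2r lerD2l ler_pM2l ?invr_gt0 ?mulr_gt0//.
have r2 := residual_L2 (T:=T) aW Wbar2 B2 chi2.
rewrite -pairing_residual//.
have := pairing_ge0 T (fun z => residual u z + (-1) *: Y z).
by rewrite pairing_sqrD//; lra.
Qed.

Lemma linearized_action_cvg (nu_ : nat -> R) (u : nat -> triple) (x : triple) Z M Y :
  (forall k, 0 < nu_ k) -> nu_ k @[k --> \oo] --> (0 : R) ->
  pairings_cvg T u x -> L2 Y -> admissible T Z M ->
  linearized_action (nu_ k) (u k) Z M Y @[k --> \oo] --> linearized_action 0 x Z M Y.
Proof.
move=> nu0 nuc [cE cB cchi] Y2 aZM; have [Z2 M2] := admissible_L2 aZM.
have ac : a_ (nu_ k) @[k --> \oo] --> a_ 0 by exact: a_cvg.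
have c1 := cE _ Z2; have c2 := cB _ (in_Lp2_1 M2); have c3 := cE _ V02.
have c4 := cchi _ gV02; have c5 := cchi _ Y2; have c6 := cB _ (in_Lp2_1 Y2).
rewrite /linearized_action.
have cc (r : R) : r @[k --> \oo] --> r by exact: cvg_cst.
apply: cvgD; first apply: cvgB; first apply: cvgB => //.
- exact: cvgM.
- apply: cvgM => //; apply: cvgD; exact: cvgM.
- apply: cvgB; last by apply: cvgD => //; apply: cvgM => //; exact: cvgM.
  apply: cvgD; first by apply: cvgD => //; apply: cvgM => //; exact: cvgM.
  apply: cvgM => //; apply: cvgB => //; apply: cvgM => //.
  by apply: cvgB => //; exact: cvgB.
Qed.

Lemma weak_residual_cvg (nu_ : nat -> R) (u : nat -> triple) (x : triple)
    (psi : Q -> 'M[R]_d) (p : Q -> R) :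
  nu_ k @[k --> \oo] --> (0 : R) -> pairings_cvg T u x ->
  (forall i j, smooth (fun z => psi z i j)) -> smooth p ->
  - pairing T (uB (u k)) (test_Dt psi) - weak_rhs T (nu_ k) (u k) psi p
    @[k --> \oo] --> - pairing T (uB x) (test_Dt psi) - weak_rhs T 0 x psi p.
Proof.
move=> nuc [cE cB cchi] sp sp'.
have c1 := cE _ (test_div_L2 T sp); have c2 := cE _ (test_grad_L2 T sp').
have c3 := cchi _ (test_hess_L2 T sp').
have c4 := cchi _ (test_graddiv_L2 T sp).
have c5 := cB _ (in_Lp2_1 (test_Dt_L2 T sp)).
exact: weak_rhs_cvg c5 c1 c2 c3 c4 nuc.
Qed.

Lemma EBPsi_L2 nu (u : triple) : EBPsi T nu u -> [/\ L2 (uE u), L2 (uB u) & L2 (uchi u)].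
Proof. by move=> [[E2 B2 chi2 _ _] _]; split => //; exact: in_Lpy_2. Qed.

(** If [x] solves the equation at 0, a nearly optimal [(Z, M)] at [x] gives a minorant of the tail.
    If not, some test pair has a nonzero residual at [x], hence along the tail, where the extended
    functionals are then infinite. *)
Lemma action_liminf (nu_ : nat -> R) (u : nat -> triple) (x : triple) :
  (forall k, 0 < nu_ k) -> nu_ k @[k --> \oo] --> (0 : R) ->
  pairings_cvg T u x -> (exists nu, EBPsi T nu x) ->
  (A_NS_ext 0 x <= limn_einf (fun k => A_NS_ext (nu_ k) (u k)))%E.
Proof.
move=> nu0 nuc ux [nu' EBx].
have [E2 B2 chi2] := EBPsi_L2 EBx.
have [EB0|nEB0] := pselect (EBPsi T 0 x).
  apply: limn_einf_ge => c; rewrite /A_NS_ext asboolT// A_NSE//.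
  rewrite -lteBlDr// -EFinB => cMM.
  have [Z [M [aZM cZM]]] := MM_gt (shifted_E_L2 0 E2) (NN_L2 (a_ 0) B2) cMM.
  have [Z2 M2] := admissible_L2 aZM.
  have Y2 := residual_L2 (T:=T) aW Wbar2 B2 chi2.
  have lc := linearized_action_cvg nu0 nuc ux Y2 aZM.
  (* The tangent point is the residual of the limit, where the linearization of the square is
     exact. *)
  have cx : c < linearized_action 0 x Z M (residual x).
    move: cZM; rewrite MM_integrandE// lte_fin ltrBlDr => /lt_le_trans; apply.
    rewrite lerD2l /action_remainder lerD2r lerD2l ler_pM2l ?invr_gt0 ?mulr_gt0//.
    by rewrite -pairing_residual//; lra.
  have H : \forall k \near \oo, c < linearized_action (nu_ k) (u k) Z M (residual x).
    exact: (cvgr_gt _ lc).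
  apply: filterS H => k ck.
  case: asboolP => [/EBPsi_L2[Ek Bk chik]|_]; last exact: leey.
  apply: le_trans (linearized_action_le (nu_ k) Ek Bk chik Y2 aZM).
  by rewrite lee_fin ltW.
apply: limn_einf_ge => c _.
have [psi [p [sp [pp [symp [psi0 [pL npsi]]]]]]] :
   exists (psi : Q -> 'M[R]_d) (p : Q -> R),
    (forall i j, smooth (fun z => psi z i j)) /\
    x_periodic psi /\ symmetric_field psi /\ (forall x, psi (0, x) = 0) /\
    is_inverse_Laplacian
      (fun z => \sum_i \sum_j Dx i (Dx j (fun y => psi y i j)) z) p /\
    - pairing T (uB x) (test_Dt psi) - weak_rhs T 0 x psi p != 0.
  (* Integrability and symmetry do not depend on [nu] and come from [EBx]; only the equation can
     fail. *)
  apply: contrapT => H; apply: nEB0; case: EBx => h1 _; split => //.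
  apply/EB_weakP => // psi p h2 h3 h4 h5 h6; apply/eqP; rewrite -subr_eq0.
  by apply/negPn/negP => h7; apply: H; exists psi, p.
have sp' : smooth p by case: pL.
have rc := weak_residual_cvg nuc ux sp sp'.
have H : \forall k \near \oo,
    - pairing T (uB (u k)) (test_Dt psi) - weak_rhs T (nu_ k) (u k) psi p != 0.
  exact: (cvgr_neq0 _ rc).
apply: filterS H => k.
rewrite /A_NS_ext; case: asboolP => [EBk|_]; last by rewrite leey.
have [Ek Bk chik] := EBPsi_L2 EBk.
case: EBk => _ /(EB_weakP _ Ek Bk chik) EBk.
by rewrite (EBk psi p) ?subrr ?eqxx.
Qed.

End liminf.

(** * Recovery sequence *)

(** [m_ k] is the largest [m <= k] with [P m k]; the first hypothesis ensures that there is one for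
    every [k]. *)
Lemma diagonal_sequence (P : nat -> nat -> Prop) :
  (forall k, P 0 k) -> (forall m, \forall k \near \oo, P m k) ->
  exists m_ : nat -> nat, (forall k, P (m_ k) k) /\
    forall M, \forall k \near \oo, (M <= m_ k)%N.
Proof.
move=> P0 PP.
exists (fun k => \max_(i < k.+1 | `[< P i k >]) i)%N; split=> [k|M].
  have H0 : `[< P (ord0 : 'I_k.+1) k >] by apply/asboolP; exact: P0.
  have [i /asboolP Pi ->] : {i : 'I_k.+1 | `[< P i k >] &
      (\max_(i < k.+1 | `[< P i k >]) i)%N = i}.
    by apply: eq_bigmax_cond; apply/card_gt0P; exists ord0.
  exact: Pi.
near=> k.
have Mk : (M < k.+1)%N.
  by rewrite ltnS; near: k; exists M.
have PMk : P M k by near: k; exact: PP.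
apply: (@leq_bigmax_cond _ _ _ (Ordinal Mk)).
exact/asboolP.
Unshelve. all: by end_near. Qed.

(** The arithmetic of the duality estimate: [EZ] stands for the pairing of [E] with [Z], [I] for
    that of [Id] with [M], [N] for [2 nu e] and [G] for [N - c Vbar]. The new value is [1 - eps]
    times the old one plus [GZ - c I / 2]. By Young, [GZ <= |G|^2 / (2 c) + c ZZ / 2]; here
    [ZZ <= I] absorbs the last term, and [|G|^2 <= 2 NN + 2 c^2 VV]. *)
Lemma recovery_MM_bound (R : realType)
    (a aV c eps m n NN NV VV ZZ I EZ VZ BM eZ GZ : R) :
  0 < c -> 0 <= eps -> 0 <= m -> a = c + (1 - eps) * aV ->
  0 <= NN + 2 * (- c) * NV + (- c) ^+ 2 * VV + 2 * (- c) * GZ + (- c) ^+ 2 * ZZ ->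
  0 <= NN + 2 * c * NV + c ^+ 2 * VV -> ZZ <= I -> GZ = n * eZ + (- c) * VZ ->
  EZ - aV * VZ - 2^-1 * (aV * I + 2 * BM) <= m ->
  eps <= 1 ->
  (1 - eps) * EZ + n * eZ - a * VZ - 2^-1 * (a * I + 2 * ((1 - eps) * BM)) <=
  m + c * VV + NN / c.
Proof.
move=> c0 e0 m0 aE P1 P2 PZ GZE H e1.
have K : GZ - 2^-1 * c * I <= NN / c + c * VV.
  have hc : c * (NN / c) = NN by rewrite mulrC divfK// gt_eqF.
  rewrite -(ler_pM2l c0) [leRHS]mulrDr hc.
  have : c ^+ 2 * ZZ <= c ^+ 2 * I by rewrite ler_wpM2l// sqr_ge0.
  by rewrite sqrrN in P1; lra.
have -> : (1 - eps) * EZ + n * eZ - a * VZ - 2^-1 * (a * I + 2 * ((1 - eps) * BM)) =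
   (1 - eps) * (EZ - aV * VZ - 2^-1 * (aV * I + 2 * BM)) + (GZ - 2^-1 * c * I).
  by rewrite aE GZE; field.
have l0 : 0 <= 1 - eps by rewrite subr_ge0.
have := ler_wpM2l l0 H; have := mulr_ge0 e0 m0; lra.
Qed.

Section recovery.
Context {R : realType} {d : nat}.
Variables (T : R).
Local Notation Q := (R * 'rV[R]_d)%type.
Local Notation mu := (QT_measure d T).
Local Notation L2 := (in_Lp mu 2%:E).
Local Notation triple := (triple (R:=R) (d:=d)).

(** A relation, as weak derivatives are only determined almost everywhere; the divergence contracts
    the first index. *)
Definition weak_div (X : Q -> 'M[R]_d) (e : Q -> 'rV[R]_d) :=
  exists g : 'I_d -> 'I_d -> Q -> R,
    (forall l i, weak_Dx T l (fun z => X z l i) (g l i)) /\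
    e = fun z => \row_i \sum_l g l i z.

Lemma weak_div_L2 X e : weak_div X e -> L2 e.
Proof.
move=> [g [gD ->]] i j; under eq_fun do rewrite mxE.
by apply: L2_sum => l _; have [] := gD l j.
Qed.

Lemma weak_div0 : weak_div (fun=> 0) (fun=> 0).
Proof.
exists (fun _ _ _ => 0); split; last first.
  by apply/funext => z; apply/rowP => i; rewrite !mxE big1.
move=> l i; split; first exact: L2_0.
move=> th _ _; rewrite ip0l oppr0.
by under [X in ip _ X]eq_fun do rewrite mxE; rewrite ip0l.
Qed.

(** Used with [J = d] for the divergence of a test matrix and with [J = 1] for the gradient of the
    potential [p]. *)
Lemma weak_div_pairing (J : nat) (theta : 'I_d -> 'I_J -> Q -> R) X e :
  L2 X -> weak_div X e -> (forall i j, smooth (theta i j)) ->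
  (forall i j, x_periodic (theta i j)) ->
  pairing T e (fun z => \row_i \sum_j theta i j z) =
  - pairing T X (fun z => \matrix_(l, i) \sum_j Dx l (theta i j) z).
Proof.
move=> X2 eX sth pth; have e2 := weak_div_L2 eX.
have [g [gD eE]] := eX.
have th2 i j : theta i j \in Lfun mu 2%:E by exact: smooth_L2.
have dth2 l i j : Dx l (theta i j) \in Lfun mu 2%:E by exact: smooth_Dx_L2.
have g2 l i : g l i \in Lfun mu 2%:E by have [] := gD l i.
rewrite !pairingE//; first last.
- by move=> i j; under eq_fun do rewrite mxE; apply: L2_sum => k _.
- by move=> i j; under eq_fun do rewrite mxE; apply: L2_sum => k _.
rewrite big_ord1 [in RHS]exchange_big -sumrN; apply: eq_bigr => i _.
rewrite -sumrN.
have -> : (fun z => (\row_i \sum_j theta i j z) 0 i) = fun z => \sum_j theta i j z.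
  by apply/funext => z; rewrite mxE.
have -> : (fun z => e z 0 i) = fun z => \sum_l g l i z.
  by apply/funext => z; rewrite eE mxE.
rewrite ip_suml//; last by apply: L2_sum.
apply: eq_bigr => l _.
have -> : (fun z => (\matrix_(l, i) \sum_j Dx l (theta i j) z) l i) =
    fun z => \sum_j Dx l (theta i j) z by apply/funext => z; rewrite mxE.
rewrite ipC ip_suml// [in RHS]ipC ip_suml// -sumrN; apply: eq_bigr => j _.
by rewrite ipC [in RHS]ipC; have [_ ->] := gD l i; rewrite ?opprK.
Qed.

Lemma weak_div_dense (F : Q -> 'M[R]_d) (s : R) : L2 F -> symmetric_field F -> 0 < s ->
  exists X e, [/\ L2 X, symmetric_field X, weak_div X e &
    pairing T (fun z => X z - F z) (fun z => X z - F z) <= s].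
Proof.
move=> F2 symF s0.
(* The [d * d] entrywise errors add up to less than [s]; the successor keeps the denominator
   positive. *)
pose s' := s / (d * d).+1%:R.
have s'0 : 0 < s' by rewrite divr_gt0.
have /choice[phi phiP] : forall ij : 'I_d * 'I_d, exists f : Q -> R,
    weakly_Dx_derivable T f /\ ip mu (fun z => F z ij.1 ij.2 - f z)
      (fun z => F z ij.1 ij.2 - f z) <= s'.
  move=> ij; have [_ /(_ _ s'0)[f wf fs]] := weakly_Dx_derivable_dense (F2 ij.1 ij.2).
  by exists f.
(* One approximant per unordered pair of indices makes [X] exactly symmetric. *)
pose ord (i j : 'I_d) := if (i <= j)%N then (i, j) else (j, i).
have ordC i j : ord i j = ord j i.
  by rewrite /ord; case: ltngtP => // /val_inj ->.
have ordF i j z : F z (ord i j).1 (ord i j).2 = F z i j.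
  by rewrite /ord; case: ifP => // _ /=; rewrite -[in RHS]symF mxE.
have /choice[g gP] : forall li : 'I_d * 'I_d, exists g : Q -> R,
    weak_Dx T li.1 (phi (ord li.1 li.2)) g.
  by move=> li; have [[_ h] _] := phiP (ord li.1 li.2); exact: h.
pose X z := \matrix_(i, j) phi (ord i j) z.
have XE i j : (fun z => X z i j) = phi (ord i j) by apply/funext => z; rewrite mxE.
have X2 : L2 X by move=> i j; rewrite XE; have [[]] := phiP (ord i j).
exists X, (fun z => \row_i \sum_l g (l, i) z); split => //.
- by move=> z; apply/matrixP => i j; rewrite !mxE ordC.
- by exists (fun l i => g (l, i)); split => // l i; rewrite XE; exact: (gP (l, i)).
have XF2 := in_Lp2B X2 F2.
rewrite pairingE//.
apply: (@le_trans _ _ (\sum_(i < d) \sum_(j < d) s')).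
  apply: ler_sum => i _; apply: ler_sum => j _.
  have [_] := phiP (ord i j); apply: le_trans; rewrite le_eqVlt; apply/orP; left.
  apply/eqP/eq_Rintegral => z _; rewrite ordF !mxE; ring.
rewrite !sumr_const !card_ord -mulrnA -mulr_natr /s' mulrAC ler_pdivrMr//.
by rewrite ler_wpM2l ?ltW// ltr_nat.
Qed.

(* The equation of [EBPsi nu] only depends on [E - 2 nu div chi]; adding
   [2 nu div X] to a solution at [nu = 0] thus gives a solution at [nu] whose
   third component is [X]. *)
Definition recovery (nu eps : R) (x : triple) X (e : Q -> 'rV[R]_d) : triple :=
  ((fun z => (1 - eps) *: uE x z + (2 * nu) *: e z),
   (fun z => (1 - eps) *: uB x z), X).

Lemma Linfty_scale c (f : Q -> R) : f \in Lfun mu +oo%E ->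
  (fun z => c * f z) \in Lfun mu +oo%E.
Proof.
move=> fy; have y1 : (1 <= +oo :> \bar R)%E by rewrite leey.
have [L0 /(_ c f 0 fy L0)] := Lfun_submod_closed mu y1.
by rewrite addr0.
Qed.

Lemma recovery_EBPsi nu eps (x : triple) X e : EBPsi T 0 x ->
  L2 X -> symmetric_field X -> weak_div X e -> EBPsi T nu (recovery nu eps x X e).
Proof.
move=> EBx X2 symX eX; have [E2 B2 chi2] := EBPsi_L2 EBx.
(* With [l = 1 - eps] and [n = 2 nu]: the terms from [e], integrated by parts, cancel those from
   [X], leaving [l] times the equation at 0. *)
have cancel (l n b a1 a2 h g : R) : - b = - a1 + a2 ->
    - (l * b) = - (l * a1 + n * - g) + (l * a2 + n * - h) + n * h - n * g.
  by move=> ab; rewrite -mulrN ab; ring.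
have [[_ By _ symB _] Wx] := EBx.
have e2 := weak_div_L2 eX.
have rE2 : L2 (uE (recovery nu eps x X e)).
  by apply: in_Lp2D; exact: in_Lp2Z.
have rB2 : L2 (uB (recovery nu eps x X e)) by exact: in_Lp2Z.
split; first split => //.
- move=> i j; rewrite (_ : (fun z => _) = fun z => (1 - eps) * uB x z i j).
    exact: Linfty_scale.
  by apply/funext => z; rewrite /= mxE.
- by move=> z; rewrite /uB/= linearZ/= symB.
apply/EB_weakP => // psi p sp pp symp psi0 pL.
have [sp' pp' _ _] := pL.
have := (EB_weakP 0 E2 B2 chi2).1 Wx psi p sp pp symp psi0 pL.
have td2 := test_div_L2 T sp; have tg2 := test_grad_L2 T sp'.
have tD2 := test_Dt_L2 T sp.
rewrite /weak_rhs !mulr0 !mul0r addr0 subr0 /recovery /uE/uB/uchi/=.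
rewrite !pairingDl//; try exact: in_Lp2Z.
rewrite !pairingZl//.
have ppij i j : x_periodic (fun z => psi z i j).
  by move=> t y k /=; rewrite (pp t y k).
have -> : pairing T e (test_div psi) = - pairing T X (test_graddiv psi).
  pose th i j := Dx j (fun y => psi y i j).
  have s1 i j : smooth (th i j) by exact: smooth_derive.
  have s2 i j : x_periodic (th i j) by exact: x_periodic_derive.
  exact: (weak_div_pairing X2 eX s1 s2).
have -> : pairing T e (test_grad p) = - pairing T X (test_hess p).
  have := @weak_div_pairing 1 (fun i _ => Dx i p) X e X2 eX.
  have -> : (fun z => \row_i \sum_(j < 1) Dx i p z) = test_grad p.
    by apply/funext => z; apply/rowP => i; rewrite !mxE big_ord1.
  have -> : (fun z => \matrix_(l, i) \sum_(j < 1) Dx l (Dx i p) z) = test_hess p.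
    by apply/funext => z; apply/matrixP => l i; rewrite !mxE big_ord1.
  by apply => i _; [exact: smooth_derive|exact: x_periodic_derive].
exact: cancel.
Qed.

(** Convexity of the squared norm between [f] and [g / eps], cleared of denominators: the defect is
    a multiple of [|g - eps f|^2]. *)
Lemma pairing_convex m n (f g : Q -> 'M[R]_(m, n)) (eps b : R) : L2 f -> L2 g ->
  0 < eps -> eps <= 1 -> pairing T f f <= b -> pairing T g g <= eps ^+ 2 * b ->
  pairing T (fun z => (1 - eps) *: f z + g z) (fun z => (1 - eps) *: f z + g z) <= b.
Proof.
move=> f2 g2 e0 e1 fb gb.
have lf2 := in_Lp2Z (1 - eps) f2.
have := pairing_ge0 T (fun z => g z + (- eps) *: f z).
rewrite pairing_sqrD// => h.
have -> : pairing T (fun z => (1 - eps) *: f z + g z) (fun z => (1 - eps) *: f z + g z) =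
    pairing T g g + 2 * (1 - eps) * pairing T g f + (1 - eps) ^+ 2 * pairing T f f.
  rewrite -pairing_sqrD//.
  by congr pairing; apply/funext => z; rewrite addrC.
have f0 := pairing_ge0 T f; have g0 := pairing_ge0 T g.
rewrite -(ler_pM2l e0).
set ff := pairing T f f in fb h f0 *; set gg := pairing T g g in gb h g0 *.
set gf := pairing T g f in h *.
have l0 : 0 <= 1 - eps by rewrite subr_ge0.
have h1 := mulr_ge0 l0 h.
have h2 : eps * (1 - eps) * ff <= eps * (1 - eps) * b.
  by rewrite ler_wpM2l// mulr_ge0// ltW.
nra.
Qed.

(** The trace of the matrix inequality, read off on the basis vectors. *)
Lemma admissible_pairing Z M : admissible T Z M ->
  pairing T Z Z <= pairing T (fun _ : Q => 1%:M) M.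
Proof.
move=> aZM; have [Z2 M2] := admissible_L2 aZM.
have Id2 := @Id_L2 R d T.
have i1 := integrable_mxdot Z2 Z2; have i2 := integrable_mxdot Id2 M2.
rewrite -subr_ge0 /pairing -RintegralB//.
pose f z := mxdot 1%:M (M z) - mxdot (Z z) (Z z).
have fi : mu.-integrable setT (EFin \o f) by have := integrableB measurableT i2 i1.
have mf : measurable_fun setT (EFin \o f) by case/integrableP : fi.
have f0 : {ae mu, forall z : measurableTypeR R * 'rV[R]_d, 0 <= f z}.
  apply: filterS (QT_ae d T) => -[t y] [/= tT _].
  have [_ tens] := aZM.
  have dd (i : 'I_d) : 0 <= M (t, y) i i - Z (t, y) 0 i * Z (t, y) 0 i.
    have := tens t y tT (delta_mx 0 i); rewrite -rowE trmx_delta -colE !mxE.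
    by rewrite big_ord1 !mxE.
  rewrite /f mxdot_row /mxdot -sumrB.
  apply: sumr_ge0 => i _; rewrite (bigD1 i)//= big1 ?addr0.
    by rewrite mxE eqxx mul1r; exact: dd.
  by move=> j ji; rewrite mxE eq_sym (negbTE ji) mul0r.
(* The integrand is known to be nonnegative only almost everywhere, hence the passage to its
   absolute value. *)
rewrite (_ : \int[mu]_z _ = \int[mu]_z `|f z|).
  by apply: Rintegral_ge0 => z _; exact: normr_ge0.
congr fine; apply: ae_eq_integral => //.
  by apply/measurable_EFinP; apply: measurableT_comp => //; apply/measurable_EFinP.
by apply: filterS f0 => z fz _; rewrite /= ger0_norm.
Qed.

(** The bound is uniform over the competitors [(Z, M)] because the part [c Id] of the new matrix
    field absorbs [c |Z|^2 / 2]. *)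
Lemma recovery_MM aV nu eps a (x : triple) X e (Vbar : Q -> 'rV[R]_d) (m : R) :
  L2 (uE x) -> L2 (uB x) -> L2 e -> L2 Vbar -> 0 <= eps <= 1 ->
  0 < a - (1 - eps) * aV ->
  (MM T (fun z => (uE x z - aV *: Vbar z)%R) (NN aV (uB x)) <= m%:E)%E ->
  0 <= m ->
  (MM T (fun z => (uE (recovery nu eps x X e) z - a *: Vbar z)%R)
     (NN a (uB (recovery nu eps x X e))) <=
   (m + (a - (1 - eps) * aV) * pairing T Vbar Vbar
    + 4 * nu ^+ 2 * pairing T e e / (a - (1 - eps) * aV))%:E)%E.
Proof.
move=> E2 B2 e2 V2 /andP[e0 e1] c0 mm m0.
set c := a - (1 - eps) * aV in c0 *.
have E'2 : L2 (fun z => uE x z - aV *: Vbar z) by apply: in_Lp2B => //; exact: in_Lp2Z.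
have rE2 : L2 (uE (recovery nu eps x X e)) by apply: in_Lp2D; exact: in_Lp2Z.
have rB2 : L2 (uB (recovery nu eps x X e)) by exact: in_Lp2Z.
apply: MM_le => [||Z M aZM].
- by apply: in_Lp2B => //; exact: in_Lp2Z.
- exact: NN_L2.
have [Z2 M2] := admissible_L2 aZM.
have := MM_ge E'2 (NN_L2 aV B2) aZM => /le_trans/(_ mm); rewrite !lee_fin.
rewrite !pairing_NN//.
rewrite !pairingBl//; try exact: in_Lp2Z.
rewrite /recovery /uE/uB/= !pairingDl// ?pairingZl//; try exact: in_Lp2Z.
have PZ := admissible_pairing aZM.
have ne2 := in_Lp2Z (2 * nu) e2; have cV2 := in_Lp2Z (- c) V2.
(* [G] is the new shifted field minus [1 - eps] times the old one. *)
pose N := fun z => (2 * nu) *: e z; pose G z := N z + (- c) *: Vbar z.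
have G2 : L2 G by exact: in_Lp2D.
have P1 := pairing_ge0 T (fun z => G z + (- c) *: Z z).
have P2 := pairing_ge0 T (fun z => N z + c *: Vbar z).
rewrite pairing_sqrD// in P1; rewrite pairing_sqrD// in P2.
have GG : pairing T G G = pairing T N N + 2 * (- c) * pairing T N Vbar
    + (- c) ^+ 2 * pairing T Vbar Vbar by rewrite -pairing_sqrD.
have GZ : pairing T G Z = 2 * nu * pairing T e Z + (- c) * pairing T Vbar Z.
  by rewrite pairingDl// !pairingZl.
have NE : pairing T N N = 4 * nu ^+ 2 * pairing T e e.
  by rewrite pairingZl// pairingC pairingZl//; ring.
rewrite GG in P1.
have aE : a = c + (1 - eps) * aV by rewrite /c subrK.
rewrite -NE => H.
exact: (recovery_MM_bound c0 e0 m0 aE P1 P2 PZ GZ H e1).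
Qed.

End recovery.

(** * Upper bound: room in the box and choice of parameters *)

Section limsup.
Context {R : realType} {d : nat}.
Variables (T aV aW alpha : R).
Local Notation Q := (R * 'rV[R]_d)%type.
Local Notation mu := (QT_measure d T).
Local Notation L2 := (in_Lp mu 2%:E).
Local Notation triple := (triple (R:=R) (d:=d)).
Variables (Vbar : Q -> 'rV[R]_d) (Wbar : Q -> 'M[R]_d).
Variables (V0 : 'rV[R]_d -> 'rV[R]_d) (gV0 : 'rV[R]_d -> 'M[R]_d).
Local Notation V0' := (fun z : Q => V0 z.2).
Local Notation gV0' := (fun z : Q => gV0 z.2).
Local Notation a_ := (a_ aV alpha).
Local Notation A_NS := (A_NS T aV aW alpha Vbar Wbar V0 gV0).
Local Notation A_NS_ext := (A_NS_ext T aV aW alpha Vbar Wbar V0 gV0).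
Local Notation in_box := (in_box T aV aW alpha Vbar Wbar V0 gV0).
Local Notation b_E := (b_E T aV aW alpha Vbar Wbar V0 gV0).
Local Notation b_chi := (b_chi T aV aW alpha Vbar Wbar V0 gV0).
Local Notation action_remainder := (action_remainder T aV aW alpha Vbar Wbar V0 gV0).
Hypothesis T0 : 0 < T.
Hypothesis aV0 : 0 < aV.
Hypothesis aW0 : 0 < aW.
Hypothesis alpha0 : 0 < alpha.
Hypothesis d2 : (1 < d)%N.
Hypothesis Vbar2 : L2 Vbar.
Hypothesis Wbar2 : L2 Wbar.
Hypothesis V02 : L2 V0'.
Hypothesis gV02 : L2 gV0'.
Local Notation residual u := (fun z => uchi u z - uB u z - aW *: Wbar z).

Lemma a_gt0 nu : 0 < a_ nu.
Proof. by rewrite ltr_wpDr// powR_ge0. Qed.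

Let D1 : 0 < d%:R - 1 :> R.
Proof. by rewrite subr_gt0 ltr1n. Qed.

Let D0 : 0 < d%:R :> R.
Proof. by rewrite ltr0n ltnW. Qed.

(** The last summand is positive since [d >= 2] and [T > 0]; the others, which vanish with the data,
    are only nonnegative. *)
Lemma b_E_gt0 nu : 0 <= nu -> 0 < b_E nu.
Proof.
move=> n0; have a0 := a_gt0 nu; have D3 : 0 <= 3 + d%:R :> R by rewrite addr_ge0// ltW.
rewrite /Defs.b_E probability_setT /= mulr1 ltr_wpDl//; last first.
  by rewrite !mulr_gt0 ?invr_gt0 ?exprn_gt0 ?mulr_gt0.
have sq (r : R) : 0 <= r ^+ 2 by exact: sqr_ge0.
have an := ltW a0; have aWn := ltW aW0; have Dn := ltW D0.
by do ?[exact: sq|done|apply: addr_ge0|apply: mulr_ge0|rewrite invr_ge0].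
Qed.

Lemma b_chi_gt0 nu : 0 <= nu -> 0 < b_chi nu.
Proof.
move=> n0; have a0 := a_gt0 nu; have D3 : 0 <= 3 + d%:R :> R by rewrite addr_ge0// ltW.
rewrite /Defs.b_chi probability_setT /= mulr1 ltr_wpDl//; last first.
  by rewrite !mulr_gt0 ?exprn_gt0.
have sq (r : R) : 0 <= r ^+ 2 by exact: sqr_ge0.
have an := ltW a0; have aWn := ltW aW0; have Dn := ltW D0.
by do ?[exact: sq|done|apply: addr_ge0|apply: mulr_ge0|rewrite invr_ge0].
Qed.

(** Weak-* test fields for [B] are merely L^1, beyond the reach of the L^2 calculus. *)
Lemma integrable_mxdot_y1 m n (f g : Q -> 'M[R]_(m, n)) :
  in_Lp mu +oo%E f -> in_Lp mu 1%E g ->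
  mu.-integrable setT (EFin \o (fun z => mxdot (f z) (g z))).
Proof.
move=> fy g1.
(* The L^oo norm unfolds to an essential supremum only when the total mass is positive. *)
have muT : (0 < mu setT)%E.
  by rewrite -setXTT QT_measureX// time_measureT// probability_setT mule1 lte_fin.
rewrite (_ : EFin \o _ =
  (fun z => \sum_i \sum_j (EFin \o (fun z => (f z i j * g z i j)%R)) z)%E); last first.
  apply/funext => z; rewrite /= /mxdot -sumEFin; apply: eq_bigr => i _.
  by rewrite -sumEFin.
apply: integrable_sum => //= i _; apply: integrable_sum => //= j _.
have /Lfun1_integrable/integrableP[mg gi] := g1 i j.
move: (fy i j); rewrite inE => /andP[]; rewrite !inE/= /finite_norm => mf.
rewrite unlock /Lnorm muT => /ess_supr_bounded[C fC].
have mfg : measurable_fun setT (EFin \o (fun z : measurableTypeR R * 'rV[R]_d => f z i j * g z i j)).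
  by apply/measurable_EFinP; apply: measurable_funM => //; apply/measurable_EFinP.
apply/integrableP; split => //.
have mg' : measurable_fun setT (fun z : measurableTypeR R * 'rV[R]_d => `|(g z i j)%:E|%E).
  exact: measurableT_comp.
apply: (@le_lt_trans _ _ (\int[mu]_z (`|C|%:E * `|(g z i j)%:E|))%E); last first.
  by rewrite ge0_integralZl_EFin// lte_mul_pinfty.
apply: ae_ge0_le_integral => //.
- exact: measurableT_comp.
- by apply: measurable_funeM.
- apply: filterS fC => z fz _; rewrite /= lee_fin normrM ler_wpM2r//.
  by rewrite (le_trans fz)// ler_norm.
Qed.

Lemma pairing_cvg0 m n (g_ : nat -> Q -> 'M[R]_(m, n)) (f : Q -> 'M[R]_(m, n))
    (eps_ : nat -> R) : L2 f -> (forall k, L2 (g_ k)) -> (forall k, 0 < eps_ k) ->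
  eps_ k @[k --> \oo] --> (0 : R) ->
  (forall k, pairing T (g_ k) (g_ k) <= eps_ k ^+ 2) ->
  pairing T (g_ k) f @[k --> \oo] --> (0 : R).
Proof.
move=> f2 g2 e0 ec ge.
apply/norm_cvg0P.
have c : eps_ k * ((1 + pairing T f f) / 2) @[k --> \oo] --> (0 : R).
  rewrite -[X in _ --> X](mul0r ((1 + pairing T f f) / 2)).
  by apply: cvgM => //; exact: cvg_cst.
apply: (squeeze_cvgr _ (cvg_cst 0) c).
by apply: nearW => k; rewrite normr_ge0/= mulrA; exact: pairing_small.
Qed.

(** * Convergence of the action along the recovery sequence *)

Section recovery_sequence.
Variables (x : triple) (nu_ eps_ : nat -> R).
Variables (X_ : nat -> Q -> 'M[R]_d) (e_ : nat -> Q -> 'rV[R]_d).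
Hypothesis EBx : EBPsi T 0 x.
Hypothesis nu0 : forall k, 0 < nu_ k.
Hypothesis nuc : nu_ k @[k --> \oo] --> (0 : R).
Hypothesis eps0 : forall k, 0 < eps_ k.
Hypothesis eps1 : forall k, eps_ k <= 1.
Hypothesis epsc : eps_ k @[k --> \oo] --> (0 : R).
Hypothesis X2 : forall k, L2 (X_ k).
Hypothesis symX : forall k, symmetric_field (X_ k).
Hypothesis Xe : forall k, weak_div T (X_ k) (e_ k).
Hypothesis Xchi : forall k,
  pairing T (fun z => X_ k z - (1 - eps_ k) *: uchi x z)
    (fun z => X_ k z - (1 - eps_ k) *: uchi x z) <= eps_ k ^+ 2.
Hypothesis ee : forall k, 4 * nu_ k ^+ 2 * pairing T (e_ k) (e_ k) <= eps_ k ^+ 2.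
Local Notation v k := (recovery (nu_ k) (eps_ k) x (X_ k) (e_ k)).

Let E2 : L2 (uE x). Proof. by have [] := EBPsi_L2 EBx. Qed.
Let B2 : L2 (uB x). Proof. by have [] := EBPsi_L2 EBx. Qed.
Let chi2 : L2 (uchi x). Proof. by have [] := EBPsi_L2 EBx. Qed.
Let e2 k : L2 (e_ k). Proof. exact: weak_div_L2 (Xe k). Qed.
Let vE2 k : L2 (uE (v k)). Proof. by apply: in_Lp2D; exact: in_Lp2Z. Qed.
Let vB2 k : L2 (uB (v k)). Proof. exact: in_Lp2Z. Qed.
Let r2 k : L2 (fun z => X_ k z - (1 - eps_ k) *: uchi x z).
Proof. by apply: in_Lp2B => //; exact: in_Lp2Z. Qed.

Let leps : 1 - eps_ k @[k --> \oo] --> (1 : R).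
Proof. by rewrite -[X in _ --> X](subr0 1); apply: cvgB => //; exact: cvg_cst. Qed.

Let scale_cvg (p : R) : (1 - eps_ k) * p @[k --> \oo] --> p.
Proof.
by rewrite -[X in _ --> X](mul1r p); apply: cvgM => //; exact: cvg_cst.
Qed.

Let nee k : pairing T (fun z => (2 * nu_ k) *: e_ k z) (fun z => (2 * nu_ k) *: e_ k z)
  = 4 * nu_ k ^+ 2 * pairing T (e_ k) (e_ k).
Proof.
have ne2 := in_Lp2Z (2 * nu_ k) (@e2 k).
by rewrite pairingZl// pairingC pairingZl//; ring.
Qed.

Lemma recovery_pairings_cvg : pairings_cvg T (fun k => v k) x.
Proof.
split=> f f2.
- have -> : (fun k => pairing T (uE (v k)) f) = fun k =>
      (1 - eps_ k) * pairing T (uE x) f + pairing T (fun z => (2 * nu_ k) *: e_ k z) f.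
    by apply/funext => k; rewrite -pairingZl// -pairingDl//; exact: in_Lp2Z.
  rewrite -[X in _ --> X]addr0; apply: cvgD => //.
  apply: (pairing_cvg0 (eps_ := eps_)) => // k; first exact: in_Lp2Z.
  by rewrite nee.
- have fpair k : pairing T (uB (v k)) f = (1 - eps_ k) * pairing T (uB x) f.
    rewrite /pairing -RintegralZl//.
      by apply: eq_Rintegral => z _; rewrite mxdotZl.
    by apply: integrable_mxdot_y1 => //; have [[_ By _ _ _] _] := EBx.
  have -> : (fun k => pairing T (uB (v k)) f) = fun k => (1 - eps_ k) * pairing T (uB x) f.
    by apply/funext => k; exact: fpair.
  exact: scale_cvg.
- have -> : (fun k => pairing T (uchi (v k)) f) = fun k =>
      (1 - eps_ k) * pairing T (uchi x) f +
      pairing T (fun z => X_ k z - (1 - eps_ k) *: uchi x z) f.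
    apply/funext => k; rewrite -pairingZl// -pairingDl//; last exact: in_Lp2Z.
    by congr pairing; apply/funext => z; rewrite addrC subrK.
  rewrite -[X in _ --> X]addr0; apply: cvgD => //.
  exact: (pairing_cvg0 (eps_ := eps_)).
Qed.

(** Weak convergence does not control the quadratic term; here the residuals converge strongly in
    L^2. *)
Lemma recovery_action_remainder_cvg :
  action_remainder (nu_ k) (v k) @[k --> \oo] --> action_remainder 0 x.
Proof.
have [cE cB cchi] := recovery_pairings_cvg.
have cc (r : R) : r @[k --> \oo] --> r by exact: cvg_cst.
have ac : a_ (nu_ k) @[k --> \oo] --> a_ 0 by exact: a_cvg.
pose Y := residual x.
have Y2 : L2 Y by exact: residual_L2.
have Yk2 k : L2 (residual (v k)) by apply: residual_L2 => //; exact: X2.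
pose w z := uchi x z - uB x z.
have w2 : L2 w by exact: in_Lp2B.
have cY : pairing T (residual (v k)) Y @[k --> \oo] --> pairing T Y Y.
  have E k : pairing T (residual (v k)) Y = pairing T (uchi (v k)) Y
      - pairing T (uB (v k)) Y - aW * pairing T Wbar Y.
    by apply: pairing_residual => //; exact: X2.
  have -> : pairing T Y Y = pairing T (uchi x) Y - pairing T (uB x) Y - aW * pairing T Wbar Y.
    exact: pairing_residual.
  rewrite (_ : (fun k => _) = fun k => pairing T (uchi (v k)) Y
      - pairing T (uB (v k)) Y - aW * pairing T Wbar Y); last by apply/funext.
  by apply: cvgB => //; apply: cvgB; [exact: cchi|apply: cB; exact: in_Lp2_1].
pose r k z := X_ k z - (1 - eps_ k) *: uchi x z.
(* The difference of the residuals is the smoothing error minus [eps_ k] times the fixed field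
   [chi - B]. *)
have rhoE k z : r k z + (- eps_ k) *: w z = residual (v k) z + (-1) *: Y z.
  rewrite /r /w /Y /recovery /uE /uB /uchi /= scaleN1r.
  apply/matrixP => i j; rewrite !mxE; ring.
have cr : pairing T (r k) (r k) @[k --> \oo] --> (0 : R).
  apply: (squeeze_cvgr _ (cc 0) epsc); apply: nearW => k.
  rewrite pairing_ge0 (le_trans (Xchi k))// expr2 ler_piMr//.
  exact: ltW.
have crw : pairing T (r k) w @[k --> \oo] --> (0 : R).
  exact: (pairing_cvg0 (eps_ := eps_)).
have crho : pairing T (r k) (r k) + 2 * (- eps_ k) * pairing T (r k) w
    + (- eps_ k) ^+ 2 * pairing T w w @[k --> \oo] --> (0 : R).
  have -> : 0 = 0 + 2 * (- 0) * 0 + ((- 0) * (- 0)) * pairing T w w :> R by ring.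
  apply: cvgD; first apply: cvgD => //.
    by apply: cvgM => //; apply: cvgM => //; exact: cvgN.
  by apply: cvgM => //; apply: cvgM; exact: cvgN.
have cYY : pairing T (residual (v k)) (residual (v k)) @[k --> \oo] --> pairing T Y Y.
  (* With [r] the residual of [v k], this is [|r|^2 = |r - Y|^2 + 2 r.Y - |Y|^2]. *)
  have E k : pairing T (residual (v k)) (residual (v k)) =
      pairing T (r k) (r k) + 2 * (- eps_ k) * pairing T (r k) w
      + (- eps_ k) ^+ 2 * pairing T w w + 2 * pairing T (residual (v k)) Y
      - pairing T Y Y.
    have alg (A B C D : R) : A = B + 2 * (-1) * C + (-1) ^+ 2 * D -> B = A + 2 * C - D.
      by move=> ->; ring.
    have fE : (fun z => r k z + - eps_ k *: w z) =
        (fun z => residual (v k) z + (-1) *: Y z).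
      by apply/funext => z; exact: rhoE.
    have P1 := pairing_sqrD (- eps_ k) (r2 k : L2 (r k)) w2.
    have P2 := pairing_sqrD (-1) (Yk2 k) Y2.
    by apply: alg; rewrite -P1 -P2 fE.
  rewrite (_ : (fun k => _) = fun k => pairing T (r k) (r k)
      + 2 * (- eps_ k) * pairing T (r k) w + (- eps_ k) ^+ 2 * pairing T w w
      + 2 * pairing T (residual (v k)) Y - pairing T Y Y); last by apply/funext.
  rewrite [X in _ --> X](_ : _ = 0 + 2 * pairing T Y Y - pairing T Y Y); last first.
    by rewrite add0r mulr_natl mulr2n addrK.
  apply: cvgB; last exact: cc.
  by apply: cvgD; [exact: crho|apply: cvgM; [exact: cc|exact: cY]].
rewrite /action_remainder; apply: cvgB; last by apply: cvgD => //; apply: cvgM => //; exact: cvgM.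
apply: cvgD; last by apply: cvgM.
apply: cvgD; first exact: cE.
by apply: cvgM; [exact: cvgM|exact: cchi].
Qed.

Lemma recovery_limsup : (limn_esup (fun k => A_NS_ext (nu_ k) (v k)) <= A_NS 0 x)%E.
Proof.
rewrite A_NSE//.
have E'2 : L2 (fun z => uE x z - a_ 0 *: Vbar z) by apply: in_Lp2B => //; exact: in_Lp2Z.
(* The zero competitor excludes the value [-oo] and gives the sign of [m] that the duality estimate
   needs. *)
have M0 : (0 <= MM T (fun z => (uE x z - a_ 0 *: Vbar z)%R) (NN (a_ 0) (uB x)))%E.
  pose Z (_ : Q) : 'rV[R]_d := 0; pose M (_ : Q) : 'M[R]_d := 0.
  have aZM : admissible T Z M.
    split; first split=> //; try exact: cst_continuous.
    - by move=> z; rewrite trmx0.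
    - by move=> t y _ w; rewrite trmx0 mul0mx subr0 mulmx0 mul0mx mxE.
  apply: le_trans (MM_ge E'2 (NN_L2 (a_ 0) B2) aZM).
  have p0 m n (f : Q -> 'M[R]_(m, n)) : pairing T f (fun=> 0) = 0.
    rewrite /pairing /Rintegral integral0_eq// => z _.
    by rewrite /mxdot big1// => i _; rewrite big1// => j _; rewrite mxE mulr0.
  by rewrite !p0 mulr0 subr0.
move: M0; case mE : (MM _ _ _) => [m| |] //; last by move=> _; rewrite addye// leey.
rewrite lee_fin => m0.
have cc (r : R) : r @[k --> \oo] --> r by exact: cvg_cst.
pose c k := a_ (nu_ k) - (1 - eps_ k) * a_ 0.
(* This lower bound turns the cost, at most [eps_ k ^+ 2 / c k], into [eps_ k / aV]. *)
have c0 k : eps_ k * aV <= c k.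
  rewrite /c a_0// /Defs.a_ mulrBl mul1r opprB addrA addrAC lerDr.
  by rewrite addrAC subrr add0r powR_ge0.
have cpos k : 0 < c k by apply: lt_le_trans (c0 k); rewrite mulr_gt0.
have ccvg : c k @[k --> \oo] --> (0 : R).
  rewrite -(subrr (a_ 0)); apply: cvgB; last exact: scale_cvg.
  exact: a_cvg.
pose n k := 4 * nu_ k ^+ 2 * pairing T (e_ k) (e_ k) / c k.
have ncvg : n k @[k --> \oo] --> (0 : R).
  have ea : eps_ k / aV @[k --> \oo] --> (0 : R).
    by rewrite -(mul0r aV^-1); apply: cvgM.
  apply: (squeeze_cvgr _ (cc 0) ea); apply: nearW => k.
  apply/andP; split.
    by rewrite mulr_ge0 ?invr_ge0 ?(ltW (cpos k))// -nee pairing_ge0.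
  rewrite ler_pdivrMr// (le_trans (ee k))//.
  rewrite mulrAC ler_pdivlMr// expr2 -mulrA ler_wpM2l//; exact: ltW.
have Ucvg : m + c k * pairing T Vbar Vbar + n k + action_remainder (nu_ k) (v k)
    @[k --> \oo] --> m + action_remainder 0 x.
  rewrite [X in _ --> X](_ : _ = m + 0 * pairing T Vbar Vbar + 0 + action_remainder 0 x).
    apply: cvgD; last exact: recovery_action_remainder_cvg.
    apply: cvgD => //; apply: cvgD => //; exact: cvgM.
  by rewrite mul0r !addr0.
apply: limn_esup_le => e eP.
have H : \forall k \near \oo,
    m + c k * pairing T Vbar Vbar + n k + action_remainder (nu_ k) (v k) <=
    m + action_remainder 0 x + e.
  by apply: (cvgr_le _ Ucvg); rewrite ltrDl.
apply: filterS H => k Hk; rewrite /A_NS_ext; case: asboolP => [_|nEB]; last first.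
  by exfalso; apply: nEB; exact: recovery_EBPsi.
rewrite A_NSE//; last exact: X2.
apply: (@le_trans _ _ ((m + c k * pairing T Vbar Vbar + n k)%:E + (action_remainder (nu_ k) (v k))%:E)%E).
  apply: leeD => //; apply: recovery_MM => //.
  - by rewrite (ltW (eps0 k)) eps1.
  - exact: cpos.
  - by rewrite mE.
by rewrite -!EFinD lee_fin.
Qed.

End recovery_sequence.

(** For [E] and [chi] the correction fits in the room freed by the scaling; [B] only shrinks. *)
Lemma recovery_in_box nu0 nu eps b (x : triple) X e : EBPsi T 0 x -> in_box nu0 x ->
  L2 X -> L2 e -> 0 < eps -> eps <= 1 -> b <= b_E nu0 -> b <= b_chi nu0 ->
  pairing T (fun z => X z - (1 - eps) *: uchi x z)
    (fun z => X z - (1 - eps) *: uchi x z) <= eps ^+ 2 * b ->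
  4 * nu ^+ 2 * pairing T e e <= eps ^+ 2 * b ->
  in_box nu0 (recovery nu eps x X e).
Proof.
move=> EBx [xE xchi xB] X2 e2 ep0 ep1 bE bchi Xchi ee.
have [E2 B2 chi2] := EBPsi_L2 EBx.
have ne2 := in_Lp2Z (2 * nu) e2.
have vE2 : L2 (uE (recovery nu eps x X e)) by apply: in_Lp2D; exact: in_Lp2Z.
have r2 : L2 (fun z => X z - (1 - eps) *: uchi x z).
  by apply: in_Lp2B => //; exact: in_Lp2Z.
have l0 : 0 <= 1 - eps by rewrite subr_ge0.
have e20 : 0 <= eps ^+ 2 by exact: sqr_ge0.
split.
- rewrite normL2_sqr//; rewrite normL2_sqr// in xE.
  apply: (pairing_convex E2 ne2 ep0 ep1 xE).
  rewrite pairingZl// pairingC pairingZl//.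
  have -> : 2 * nu * (2 * nu * pairing T e e) = 4 * nu ^+ 2 * pairing T e e by ring.
  by rewrite (le_trans ee)// ler_wpM2l.
- rewrite normL2_sqr//; rewrite normL2_sqr// in xchi.
  have XE : X = (fun z => (1 - eps) *: uchi x z + (X z - (1 - eps) *: uchi x z)).
    by apply/funext => z; rewrite addrC subrK.
  rewrite /recovery {1 2}/uchi /= {1 2}XE.
  apply: (pairing_convex chi2 r2 ep0 ep1 xchi).
  by rewrite (le_trans Xchi)// ler_wpM2l.
- apply: le_trans xB; rewrite unlock /Lnorm; case: ifPn => // _.
  apply: le_ess_sup; apply: nearW => z /=.
  rewrite lee_fin frobZ// !ger0_norm ?mulr_ge0 ?sqrtr_ge0//.
  by rewrite ler_piMl ?sqrtr_ge0// gerBl ltW.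
Qed.

(* [eps = 1] and [X = 0] are always admissible, so that the diagonal sequence
   can be required to satisfy the bounds at every index. *)
Lemma recovery_exists (x : triple) (nu_ : nat -> R) (b : R) : EBPsi T 0 x ->
  (forall k, 0 < nu_ k) -> nu_ k @[k --> \oo] --> (0 : R) -> 0 < b ->
  exists (eps_ : nat -> R) (X_ : nat -> Q -> 'M[R]_d) (e_ : nat -> Q -> 'rV[R]_d),
  [/\ eps_ k @[k --> \oo] --> (0 : R), (forall k, 0 < eps_ k), (forall k, eps_ k <= 1) &
    forall k, [/\ L2 (X_ k), symmetric_field (X_ k), weak_div T (X_ k) (e_ k),
      pairing T (fun z => X_ k z - (1 - eps_ k) *: uchi x z)
        (fun z => X_ k z - (1 - eps_ k) *: uchi x z) <= eps_ k ^+ 2 * b &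
      4 * nu_ k ^+ 2 * pairing T (e_ k) (e_ k) <= eps_ k ^+ 2 * b]].
Proof.
move=> EBx nu0 nuc b0; have [E2 B2 chi2] := EBPsi_L2 EBx.
have [[_ _ _ _ symchi] _] := EBx.
pose eps (m : nat) : R := m.+1%:R^-1.
have eps0 m : 0 < eps m by rewrite invr_gt0.
pose P m k := exists Xe : (Q -> 'M[R]_d) * (Q -> 'rV[R]_d),
  [/\ L2 Xe.1, symmetric_field Xe.1, weak_div T Xe.1 Xe.2,
      pairing T (fun z => Xe.1 z - (1 - eps m) *: uchi x z)
        (fun z => Xe.1 z - (1 - eps m) *: uchi x z) <= eps m ^+ 2 * b &
      4 * nu_ k ^+ 2 * pairing T Xe.2 Xe.2 <= eps m ^+ 2 * b].
have pos m : 0 < eps m ^+ 2 * b by rewrite mulr_gt0// exprn_gt0.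
have P0 k : P 0 k.
  have p0 i j : pairing T (fun _ : Q => 0 : 'M[R]_(i, j)) (fun=> 0) = 0.
    rewrite /pairing /Rintegral integral0_eq// => z _.
    by rewrite /mxdot big1// => a _; rewrite big1// => c _; rewrite mxE mulr0.
  exists (fun=> 0, fun=> 0); split => //=.
  - by apply: continuous_in_Lp2; exact: cst_continuous.
  - by move=> z; rewrite trmx0.
  - exact: weak_div0.
  - under eq_fun do rewrite /eps invr1 subrr scale0r subr0.
    by rewrite p0 ltW.
  - by rewrite p0 mulr0 ltW.
have PP m : \forall k \near \oo, P m k.
  have F2 := in_Lp2Z (1 - eps m) chi2.
  have symF : symmetric_field (fun z => (1 - eps m) *: uchi x z).
    by move=> z; rewrite linearZ/= symchi.
  have [X [e [X2 symX Xe Xs]]] := weak_div_dense F2 symF (pos m).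
  (* For fixed [m] the field [e] is fixed, however large, so the factor [nu_ k] squared wins. *)
  have cn : 4 * (nu_ k * nu_ k) * pairing T e e @[k --> \oo] --> (0 : R).
    rewrite [X in _ --> X](_ : _ = 4 * (0 * 0) * pairing T e e); last by rewrite !mulr0 mul0r.
    apply: cvgM; last exact: cvg_cst.
    by apply: cvgM; [exact: cvg_cst|exact: cvgM].
  have H : \forall k \near \oo, 4 * (nu_ k * nu_ k) * pairing T e e <= eps m ^+ 2 * b.
    exact: (cvgr_le _ cn).
  by apply: filterS H => k Hk; exists (X, e).
have [m_ [Pm mc]] := diagonal_sequence P0 PP.
have /choice[Xe XeP] := Pm.
exists (fun k => eps (m_ k)), (fun k => (Xe k).1), (fun k => (Xe k).2); split => //.
- apply/cvgrPdist_lt => r r0.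
  have [M _ /(_ M (leqnn M)) /= hM] := near_infty_natSinv_lt (PosNum r0).
  apply: filterS (mc M) => k Mk; rewrite sub0r normrN gtr0_norm//.
  apply: le_lt_trans hM; rewrite lef_pV2 ?posrE// ler_nat ltnS//.
- by move=> k; rewrite invf_le1// ler1n.
Qed.

End limsup.

Theorem proposition5p2 (R : realType) (d : nat) (T aV aW alpha nu0 : R)
  (Vbar : R * 'rV[R]_d -> 'rV[R]_d) (Wbar : R * 'rV[R]_d -> 'M[R]_d)
  (V0 : 'rV[R]_d -> 'rV[R]_d) (gV0 : 'rV[R]_d -> 'M[R]_d) :
  (d = 2 \/ d = 3)%N ->
  0 < T -> 0 < aV -> 0 < aW ->
  0 < alpha -> alpha < ((d %/ 2)%:R + 4)^-1 ->
  in_Lp (QT_measure d T) 2%:E Vbar ->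
  in_Lp (QT_measure d T) 2%:E Wbar ->
  in_Lp (torus_measure d) 2%:E V0 ->
  weakly_divergence_free V0 ->
  zero_mean V0 ->
  weak_gradient V0 gV0 ->
  in_Lp (torus_measure d) 2%:E gV0 ->
  0 < nu0 ->
  Gamma_cvg_0plus
    (fun nu (u : EB_space T aV aW alpha Vbar Wbar V0 gV0 nu0) =>
       A_NS_ext T aV aW alpha Vbar Wbar V0 gV0 nu (EB_val u))
    (fun u => A_NS_ext T aV aW alpha Vbar Wbar V0 gV0 0 (EB_val u)).
Proof.
move=> d23 T0 aV0 aW0 alpha0 _ Vbar2 Wbar2 V02 _ _ _ gV02 nu00 nu_ nupos nuc.
have d2 : (1 < d)%N by case: d23 => ->.
have V02' := in_Lp_snd T V02; have gV02' := in_Lp_snd T gV02.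
have EBP (x : EB_space T aV aW alpha Vbar Wbar V0 gV0 nu0) :
    EB_set T aV aW alpha Vbar Wbar V0 gV0 nu0 (EB_val x) by exact: set_valP.
split=> [x u ux|x].
  apply: action_liminf => //; first exact/EB_space_cvgP.
  by have [[nu _ EBx] _] := EBP x; exists nu.
have [EB0|nEB0] := pselect (EBPsi T 0 (EB_val x)); last first.
  (* The limit functional is infinite at such an [x], so the constant sequence will do. *)
  exists (fun=> x); first exact: cvg_cst.
  by rewrite [leRHS]/A_NS_ext asboolF// leey.
have [_ xbox] := EBP x.
(* The two box bounds keep the sequence in the space; the bound 1 gives the plain rate [eps ^+ 2]
   used in the convergence estimates. *)
pose b := Num.min 1 (Num.min (b_E T aV aW alpha Vbar Wbar V0 gV0 nu0)
                             (b_chi T aV aW alpha Vbar Wbar V0 gV0 nu0)).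
have b0 : 0 < b.
  rewrite !lt_min ltr01 b_E_gt0//; last exact: ltW.
  by rewrite b_chi_gt0// ltW.
have [eps_ [X_ [e_ [epsc eps0 eps1 XeP]]]] := recovery_exists EB0 nupos nuc b0.
pose v k := recovery (nu_ k) (eps_ k) (EB_val x) (X_ k) (e_ k).
have vEB k : EBPsi T (nu_ k) (v k).
  by have [? ? ? _ _] := XeP k; exact: recovery_EBPsi.
have vset k : EB_set T aV aW alpha Vbar Wbar V0 gV0 nu0 (v k).
  have [X2 symX Xe Xchi ee] := XeP k.
  split; first by exists (nu_ k); rewrite ?ltW.
  apply: (recovery_in_box (b := b)) => //; first exact: weak_div_L2 Xe.
    by rewrite !ge_min lexx orbT.
  by rewrite !ge_min lexx !orbT.
have b1 : b <= 1 by rewrite ge_min lexx.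
have le1 k (r : R) : r <= eps_ k ^+ 2 * b -> r <= eps_ k ^+ 2.
  by move=> /le_trans; apply; rewrite ler_piMr// sqr_ge0.
have X2 k : in_Lp (QT_measure d T) 2%:E (X_ k) by have [] := XeP k.
have symX k : symmetric_field (X_ k) by have [] := XeP k.
have Xe k : weak_div T (X_ k) (e_ k) by have [] := XeP k.
have Xchi k := le1 k _ (let: And5 _ _ _ h _ := XeP k in h).
have ee k := le1 k _ (let: And5 _ _ _ _ h := XeP k in h).
exists (fun k => SigSub (mem_set (vset k)) : EB_space T aV aW alpha Vbar Wbar V0 gV0 nu0).
  apply/EB_space_cvgP; change (pairings_cvg T (fun k => v k) (EB_val x)).
  exact: recovery_pairings_cvg.
rewrite [leRHS]/A_NS_ext asboolT//.
change (limn_esup (fun k => A_NS_ext T aV aW alpha Vbar Wbar V0 gV0 (nu_ k) (v k))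
        <= A_NS T aV aW alpha Vbar Wbar V0 gV0 0 (EB_val x))%E.
exact: recovery_limsup.
Qed.
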